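(* Let $\Omega \subset \mathbb{C}^d$, $d \ge 1$, be a Kobayashi hyperbolic domain and let $U \subset \mathbb{C}^d$ be an open set such that $U \cap \partial\Omega \neq \emptyset$ and, moreover, $\#(U \cap \partial \Omega) > 1$. Suppose that every pair of distinct points of $U \cap \partial \Omega$ has the weak visibility property with respect to $(\Omega, \mathsf{k}_{\Omega})$. Then for every open set $W \subset \mathbb{C}^d$ with $W \cap \Omega \neq \emptyset$ and $W \subset\subset U$, there exists a constant $C > 0$, depending only on $U, W$, such that for all $z, w \in W \cap \Omega$, $$\mathsf{k}_{U \cap \Omega}(z, w) \le \mathsf{k}_{\Omega}(z, w) + C.$$
   Context: $\mathsf{k}_D$ denotes the Kobayashi pseudodistance of $D$ and $\kappa_D(z;v)$ ($z\in D$, $v \in \mathbb{C}^d$) the Kobayashi--Royden pseudometric of $D$; a domain $D \subset \mathbb{C}^d$ is Kobayashi hyperbolic if $\mathsf{k}_D$ is a distance. $X \subset\subset U$ means that $\overline{X}$ is compact and $\overline{X} \subset U$. $\partial$ denotes the boundary in $\mathbb{C}^d$, and $\#$ denotes cardinality. For $\kappa \ge 0$, a $(1,\kappa)$-almost-geodesic of $(D, \mathsf{k}_D)$ is an absolutely continuous curve $\gamma : I \to D$ on an interval $I \subset \mathbb{R}$ such that $|t-s| - \kappa \le \mathsf{k}_D(\gamma(s),\gamma(t)) \le |t-s| + \kappa$ for all $s,t \in I$ and $\kappa_D(\gamma(t);\gamma'(t)) \le 1$ for almost every $t \in I$. Weak visibility: for a Kobayashi hyperbolic domain $D$, a pair of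 distinct points $p, q \in \partial D$ has the weak visibility property with respect to $(D, \mathsf{k}_D)$ if for every $\kappa \ge 0$ there exist neighbourhoods $V_p$ of $p$ and $V_q$ of $q$ in $\mathbb{C}^d$ with $\overline{V_p} \cap \overline{V_q} = \emptyset$ and a compact set $K \subset D$ such that every $(1,\kappa)$-almost-geodesic $\gamma : [0,a] \to D$ of $(D,\mathsf{k}_D)$ with $\gamma(0) \in V_p \cap D$ and $\gamma(a) \in V_q \cap D$ satisfies $\gamma([0,a]) \cap K \neq \emptyset$.
   Formalization: The inequality is asserted for z, w in W ∩ Ω lying in the same connected component of U ∩ Ω (with C uniform over components), since for points in different components of U ∩ Ω the distance k_{U∩Ω} is infinite or undefined and the claim fails. *)

(* Defs.v *)
From HB Require Import structures.
From mathcomp Require Import all_boot all_order all_algebra.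
From mathcomp Require Import complex.
From mathcomp Require Import all_classical all_reals all_analysis.
Set Implicit Arguments.
Unset Strict Implicit.
Unset Printing Implicit Defensive.
Import Order.TTheory GRing.Theory Num.Theory.
Import numFieldNormedType.Exports.
Local Open Scope classical_set_scope.
Local Open Scope ring_scope.

(* [R[i]] packaged as a [numClosedFieldType], so that the topology and the
   norm that the analysis library puts on every such field are inferred.  The
   norm of [CC R], and that of [CC R]-modules, is [CC R]-valued. *)
Definition CC (R : realType) : numClosedFieldType := R[i].

Definition toCC (R : realType) (x : R) : CC R := x%:C%C.

(* C^d; its canonical norm is the maximum norm. *)
Notation "''CC[' R ]_ d" := ('rV[CC R]_d)
  (at level 8, d at level 2, format "''CC[' R ]_ d") : type_scope.

Definition boundary (T : topologicalType) (A : set T) : set T :=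
  closure A `\` interior A.

Definition relcompact (T : topologicalType) (A B : set T) : Prop :=
  compact (closure A) /\ closure A `<=` B.

Section Kobayashi.
Variables (R : realType) (d : nat).
Implicit Types (D : set 'CC[R]_d) (z w v : 'CC[R]_d).

Definition is_domain D : Prop := [/\ D !=set0, open D & connected D].

(* Only the values on the open unit disc matter. *)
Definition holo_disc D (f : CC R -> 'CC[R]_d) : Prop :=
  forall x : CC R, `|x| < 1 -> derivable f x 1 /\ D (f x).

(* Poincare distance of the unit disc, of curvature -4: artanh of the
   pseudohyperbolic distance.  It is the integrated form of the metric
   |v| / (1 - |z|^2), so that [kobayashi] and [kobayashi_royden] below are
   normalised consistently. *)
Definition poincare (a b : CC R) : R :=
  let r : R := complex.Re `|(a - b) / (1 - a^* * b)| in
  ln ((1 + r) / (1 - r)) / 2.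

Definition kob_chain D z w (s : R) : Prop :=
  exists (m : nat) (p : nat -> 'CC[R]_d) (f : nat -> CC R -> 'CC[R]_d)
         (a b : nat -> CC R),
    [/\ p 0%N = z, p m.+1 = w,
        forall j, (j < m.+1)%N ->
          [/\ holo_disc D (f j), `|a j| < 1, `|b j| < 1,
              f j (a j) = p j & f j (b j) = p j.+1] &
        s = \sum_(j < m.+1) poincare (a j) (b j)].

(* [D] need not be connected; the value is +oo when no chain of discs in [D]
   joins [z] to [w]. *)
Definition kobayashi D z w : \bar R :=
  ereal_inf [set s%:E | s in kob_chain D z w].

Definition kobayashi_royden D z v : \bar R :=
  ereal_inf [set t%:E | t in [set t : R | 0 < t /\
    exists f : CC R -> 'CC[R]_d,
      [/\ holo_disc D f, f 0 = z & toCC t *: derive1 f 0 = v]]].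

(* [kobayashi D] is always a pseudodistance on a domain [D]. *)
Definition kob_hyperbolic D : Prop :=
  forall z w, D z -> D w -> kobayashi D z w = 0%E -> z = w.

Definition abs_continuous (I : set R) (g : R -> 'CC[R]_d) : Prop :=
  forall e : R, 0 < e -> exists2 dl : R, 0 < dl &
    forall (n : nat) (a b : nat -> R),
      (forall k, (k < n)%N -> a k <= b k /\ `[a k, b k] `<=` I) ->
      (forall j k, (j < n)%N -> (k < n)%N -> j != k ->
         `]a j, b j[ `&` `]a k, b k[ = set0) ->
      \sum_(k < n) (b k - a k) < dl ->
      \sum_(k < n) `|g (b k) - g (a k)| < toCC e.

(* [v] is the derivative of the curve [g] at [t], with respect to the real
   parameter. *)
Definition curve_deriv (g : R -> 'CC[R]_d) (t : R) v : Prop :=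
  (fun h : R => toCC h^-1 *: (g (t + h) - g t)) @ 0^' --> v.

(* (1, kappa)-almost-geodesics; [I] is meant to be an interval, and the values
   of [g] outside [I] are irrelevant. *)
Definition almost_geodesic D (kappa : R) (I : set R) (g : R -> 'CC[R]_d)
    : Prop :=
  [/\ forall t, I t -> D (g t),
      abs_continuous I g,
      forall s t, I s -> I t ->
        ((`|t - s| - kappa)%:E <= kobayashi D (g s) (g t))%E /\
        (kobayashi D (g s) (g t) <= (`|t - s| + kappa)%:E)%E &
      {ae lebesgue_measure, forall t : R, I t ->
        exists2 v, curve_deriv g t v & (kobayashi_royden D (g t) v <= 1)%E}].

Definition weak_visible D (p q : 'CC[R]_d) : Prop :=
  forall kappa : R, 0 <= kappa ->
    exists Vp Vq K : set 'CC[R]_d,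
      [/\ nbhs p Vp, nbhs q Vq, closure Vp `&` closure Vq = set0,
          compact K /\ K `<=` D &
          forall (a : R) (g : R -> 'CC[R]_d),
            0 <= a -> almost_geodesic D kappa `[0, a] g ->
            (Vp `&` D) (g 0) -> (Vq `&` D) (g a) ->
            (g @` `[0, a]) `&` K !=set0].

End Kobayashi.

(* Main.v *)
Require Import Defs.
From HB Require Import structures.
From mathcomp Require Import all_boot all_order all_algebra.
From mathcomp Require Import complex.
From mathcomp Require Import all_classical all_reals all_analysis.
From mathcomp Require Import ring lra.
Set Implicit Arguments.
Unset Strict Implicit.
Unset Printing Implicit Defensive.
Import Order.TTheory GRing.Theory Num.Theory.
Import numFieldNormedType.Exports.
Local Open Scope classical_set_scope.
Local Open Scope ring_scope.

(** Localisation of the Kobayashi distance means that a near-shortest chain of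
    discs in [Omega] between two points of [W] can be replaced by a chain in
    [U `&` Omega] that is longer by at most a constant.

    A chain of discs of total length [L] traces a curve [g] on [[0, L]]
    made of hyperbolic geodesic segments ([dc_exists]). If [L] exceeds the
    distance of the endpoints by at most [1], then [g] is a
    (1,1)-almost-geodesic ([ageo_almost]). The metric conditions are immediate
    from the definition of the distance. Absolute continuity is not: it
    requires that a function which is merely complex differentiable be locally
    Lipschitz, and this follows from Goursat's theorem and Cauchy's formula
    ([goursat], [cauchy_formula], [holo_lipschitz]).

    Weak visibility of pairs of boundary points then yields a single compact
    set met by all almost-geodesics that cross from one region out of a larger
    one ([visible_compact]). Together with Barth's theorem ([hyperbolic_nbhs])
    it shows that the distance of a point [z] near [W] to the complement of
    [U] is bounded below ([dist_lower]), and that up to a constant it is at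
    least the distance from [z] to a fixed base point ([dist_growth]).

    A disc centred at [z] stays in [U] up to hyperbolic radius [delta], the
    distance of [z] to the complement of [U]. Rescaling it gives a
    quantitative form of Royden's localisation lemma: a short segment starting
    at [z] has in [U `&` Omega] a length larger by a factor
    [1 + O(exp (- 2 delta))] only ([th_shrink], [link_shrink], [disc_stays]).
    Along an almost-geodesic that stays near [W], let [t0] be the time at which
    it is closest to the base point. Then [delta] at time [t] is at least
    [|t - t0| / 2] up to a constant, by the triangle inequality, so the total
    excess is bounded by the integral of a multiple of [exp (- |t - t0|)],
    independently of the length ([almost_geodesic_localizes]).

    An almost-geodesic that does leave the vicinity of [W] meets, on its way
    out and on its way back, a compact set ([localized_exit]). The part before
    the first such point and the part after the second are localised as above,
    and the two points, which lie in a compact subset of [U `&` Omega], are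
    joined there at bounded cost ([joined_bounded]). *)

(** * Real-valued norms and complex derivatives *)

Section RealNorm.
Context {R : realType}.
Implicit Types (V : normedModType (CC R)) (e r s t : R) (a b c z w : CC R).

(** The norms of [CC R]-modules take values in [CC R], where order is partial;
    this is the same norm as a real number. *)
Definition nr V (x : V) : R := complex.Re `|x|.

Lemma toCCD r s : toCC (r + s) = toCC r + toCC s.
Proof. by rewrite /toCC rmorphD. Qed.

Lemma toCCN r : toCC (- r) = - toCC r.
Proof. by rewrite /toCC rmorphN. Qed.

Lemma toCCB r s : toCC (r - s) = toCC r - toCC s.
Proof. by rewrite /toCC rmorphB. Qed.

Lemma toCCM r s : toCC (r * s) = toCC r * toCC s.
Proof. by rewrite /toCC rmorphM. Qed.

Lemma toCC0 : toCC (0 : R) = 0.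
Proof. by rewrite /toCC rmorph0. Qed.

Lemma toCC1 : toCC (1 : R) = 1.
Proof. by rewrite /toCC rmorph1. Qed.

Lemma toCCV r : toCC r^-1 = (toCC r)^-1.
Proof. by rewrite /toCC fmorphV. Qed.

Lemma toCCX r n : toCC (r ^+ n) = toCC r ^+ n.
Proof. by rewrite /toCC rmorphXn. Qed.

Lemma lt_toCC r s : (toCC r < toCC s) = (r < s).
Proof. exact: ltcR. Qed.

Lemma le_toCC r s : (toCC r <= toCC s) = (r <= s).
Proof. exact: lecR. Qed.

Lemma toCC_inj : injective (@toCC R).
Proof. exact: complexI. Qed.

Lemma nrE V (x : V) : `|x| = toCC (nr x).
Proof.
rewrite /nr /toCC; have := normr_ge0 x; case: `|x| => a b.
by rewrite lecE /= => /andP[/eqP -> _].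
Qed.

Lemma nr_lt V (x : V) e : (`|x| < toCC e) = (nr x < e).
Proof. by rewrite nrE lt_toCC. Qed.

Lemma nr_lt1 V (x : V) : (`|x| < 1) = (nr x < 1).
Proof. by rewrite -toCC1 nr_lt. Qed.

Lemma nr_ge0 V (x : V) : 0 <= nr x.
Proof. by rewrite -le_toCC -nrE toCC0. Qed.

Lemma nrD V (x y : V) : nr (x + y) <= nr x + nr y.
Proof. by rewrite -le_toCC toCCD -!nrE ler_normD. Qed.

Lemma nrN V (x : V) : nr (- x) = nr x.
Proof. by rewrite /nr normrN. Qed.

Lemma nrB V (x y : V) : nr (x - y) <= nr x + nr y.
Proof. by rewrite -(nrN y) nrD. Qed.

Lemma nr_sym V (x y : V) : nr (x - y) = nr (y - x).
Proof. by rewrite -nrN opprB. Qed.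

Lemma nr_tri V (y x z : V) : nr (x - z) <= nr (x - y) + nr (y - z).
Proof. by apply: le_trans (nrD _ _); rewrite addrA subrK. Qed.

Lemma nrZ V a (x : V) : nr (a *: x) = nr a * nr x.
Proof. by apply: toCC_inj; rewrite toCCM -!nrE normrZ. Qed.

Lemma nrM a b : nr (a * b) = nr a * nr b.
Proof. by apply: toCC_inj; rewrite toCCM -!nrE normrM. Qed.

Lemma nrV a : nr a^-1 = (nr a)^-1.
Proof. by apply: toCC_inj; rewrite toCCV -!nrE normfV. Qed.

Lemma nr0 V : nr (0 : V) = 0.
Proof. by rewrite /nr normr0. Qed.

Lemma nr1 : nr (1 : CC R) = 1.
Proof. by apply: toCC_inj; rewrite -nrE normr1 toCC1. Qed.

Lemma nr_eq0 V (x : V) : (nr x == 0) = (x == 0).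
Proof. by rewrite -(inj_eq toCC_inj) -nrE toCC0 normr_eq0. Qed.

Lemma nr_gt0 V (x : V) : (0 < nr x) = (x != 0).
Proof. by rewrite lt_def nr_eq0 nr_ge0 andbT. Qed.

Lemma nr_toCC r : nr (toCC r) = `|r|.
Proof.
apply: toCC_inj; rewrite -nrE /toCC normc_def /= expr0n /= addr0.
by rewrite sqrtr_sqr.
Qed.

Lemma nr_sq a : nr a ^+ 2 = complex.Re a ^+ 2 + complex.Im a ^+ 2.
Proof.
by apply: toCC_inj; rewrite toCCX -nrE -add_Re2_Im2.
Qed.

Lemma Re_le_nr a : `|complex.Re a| <= nr a.
Proof. by rewrite -le_toCC -nrE; exact: normc_ge_Re. Qed.

Lemma Im_le_nr a : `|complex.Im a| <= nr a.
Proof.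
rewrite -(@ler_pXn2r _ 2) ?nnegrE ?nr_ge0// nr_sq real_normK ?num_real//.
by rewrite lerDr sqr_ge0.
Qed.

Lemma nr_le_ReIm a : nr a <= `|complex.Re a| + `|complex.Im a|.
Proof.
rewrite -(@ler_pXn2r _ 2) ?nnegrE ?nr_ge0 ?addr_ge0// nr_sq.
rewrite sqrrD !real_normK ?num_real// lerD2r lerDl.
by rewrite mulrn_wge0// mulr_ge0.
Qed.

Lemma nbhs_nrP V (x : V) (A : set V) :
  nbhs x A <-> exists2 e, 0 < e & forall y, nr (y - x) < e -> A y.
Proof.
split.
  move=> /nbhs_normP[/= e e0 eA].
  have [e' ee'] : exists e', e = toCC e'.
    by exists (complex.Re e); move: e0; case: (e) => p q; rewrite ltcE /= => /andP[/eqP -> _].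
  move: e0 eA; rewrite ee' => {ee'}.
  rewrite -[0 : CC R]toCC0 lt_toCC => e0 eA; exists e' => // y xy.
  by apply: eA; rewrite /ball_/= nr_lt nr_sym.
move=> [e e0 eA]; apply/nbhs_normP; exists (toCC e) => /=.
  by rewrite -[0 : CC R]toCC0 lt_toCC.
by move=> y; rewrite /ball_/= nr_lt nr_sym; exact: eA.
Qed.

Lemma cvg_nrP {T : Type} {F : set_system T} {FF : Filter F} V (f : T -> V) (y : V) :
  f @ F --> y <-> forall e, 0 < e -> \forall x \near F, nr (f x - y) < e.
Proof.
split=> [fy e e0|h A /nbhs_nrP[e e0 eA]].
  by apply: (fy [set z | nr (z - y) < e]); apply/nbhs_nrP; exists e.
by apply: filterS (h e e0) => x; exact: eA.
Qed.

Lemma cont_nrP (T : topologicalType) V (f : T -> V) (t : T) :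
  {for t, continuous f} <-> forall e, 0 < e -> nbhs t [set s | nr (f s - f t) < e].
Proof. exact: (@cvg_nrP T (nbhs t) _ V f (f t)). Qed.

(** Stated with the real-valued norm, so that estimates stay in [R]; [cdiffE]
    identifies it with the limit of difference quotients. *)
Definition cdiff V (f : CC R -> V) (x : CC R) (l : V) : Prop :=
  forall e, 0 < e -> exists2 dl, 0 < dl &
    forall y, nr (y - x) < dl -> nr (f y - f x - (y - x) *: l) <= e * nr (y - x).

Lemma dnbhs_nrP V (x : V) (A : set V) :
  x^' A <-> exists2 e, 0 < e & forall y, nr (y - x) < e -> y != x -> A y.
Proof. by rewrite /dnbhs /within /=; exact: nbhs_nrP. Qed.

Lemma cdiffE V (f : CC R -> V) x l : cdiff f x l <->
  h^-1 *: (f (h + x) - f x) @[h --> 0^'] --> l.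
Proof.
split=> [fl|fl].
  apply/cvg_nrP => e e0; have [dl dl0 H] := fl (e / 2) (divr_gt0 e0 (ltr0Sn _ _)).
  apply: (iffRL (dnbhs_nrP _ _)); exists dl => // h; rewrite subr0 => hd h0.
  have := H (h + x); rewrite addrK => /(_ hd).
  rewrite -(ler_pM2l (x := (nr h)^-1)) ?invr_gt0 ?nr_gt0// -nrV -nrZ scalerBr scalerA.
  rewrite mulVf// scale1r mulrCA nrV mulVf ?nr_eq0// mulr1 => /le_lt_trans; apply.
  by rewrite gtr_pMr// invf_lt1// ltr1n.
move=> e e0; have [dl dl0 H] := (dnbhs_nrP (0 : CC R) _).1 ((cvg_nrP _ _).1 fl e e0).
exists dl => // y yx; have [->|yNx] := eqVneq y x.
  by rewrite !subrr scale0r subr0 !nr0 mulr0.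
have h0 : y - x != 0 by rewrite subr_eq0.
have := H (y - x); rewrite subr0 subrK => /(_ yx h0) /ltW.
rewrite -(ler_pM2l (x := nr (y - x))) ?nr_gt0// -nrZ scalerBr scalerA.
by rewrite divff// scale1r mulrC.
Qed.

Lemma cdiff_derive1 V (f : CC R -> V) x l : cdiff f x l -> derive1 f x = l.
Proof. by move=> /cdiffE fl; apply: cvg_lim => //; exact: norm_hausdorff. Qed.

Lemma cdiff_derivable V (f : CC R -> V) x : derivable f x 1 <-> exists l, cdiff f x l.
Proof.
have E : (fun h : CC R => h^-1 *: ((f \o shift x) (h *: 1) - f x)) =
         (fun h : CC R => h^-1 *: (f (h + x) - f x)).
  by apply/funext => h /=; rewrite -[h *: 1]/(h * 1) mulr1.
rewrite /derivable E; split=> [/cvg_ex[l fl]|[l /cdiffE fl]].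
  by exists l; apply/cdiffE.
by apply/cvg_ex; exists l.
Qed.

Lemma cdiff_cont V (f : CC R -> V) x l : cdiff f x l -> {for x, continuous f}.
Proof.
move=> fl; apply/cont_nrP => e e0.
have [dl dl0 H] := fl 1 ltr01.
have M0 : 0 < 1 + nr l by rewrite ltr_pwDl// nr_ge0.
apply/nbhs_nrP; exists (Num.min dl (e / (1 + nr l))).
  by rewrite lt_min dl0 divr_gt0.
move=> y; rewrite lt_min ltr_pdivlMr// => /andP[yd ye].
apply: le_lt_trans ye; rewrite mulrDr mulr1 -nrZ.
rewrite -[f y - f x](subrK ((y - x) *: l)); apply: le_trans (nrD _ _) _.
by rewrite lerD2r -[leRHS]mul1r H.
Qed.

Lemma cdiff_comp V (f : CC R -> V) (phi : CC R -> CC R) x l m :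
  cdiff phi x m -> cdiff f (phi x) l -> cdiff (f \o phi) x (m *: l).
Proof.
move=> pm fl e e0.
have K0 : 0 < nr l + nr m + 1 by rewrite ltr_wpDl// addr_ge0// nr_ge0.
pose e1 := Num.min 1 (e / (nr l + nr m + 1)).
have e10 : 0 < e1 by rewrite lt_min ltr01 divr_gt0.
have e1e : e1 * (nr l + nr m + 1) <= e by rewrite -ler_pdivlMr// /e1 ge_min lexx orbT.
have [d1 d10 H1] := fl e1 e10; have [d2 d20 H2] := pm e1 e10.
have [d3 d30 H3] := (nbhs_nrP x _).1 ((cvg_nrP _ _).1 (cdiff_cont pm) d1 d10).
exists (Num.min d2 d3); first by rewrite lt_min d20 d30.
move=> y; rewrite lt_min => /andP[y2 y3] /=.
have h1 := H1 _ (H3 _ y3); have h2 := H2 _ y2.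
have hm : nr (phi y - phi x) <= (e1 + nr m) * nr (y - x).
  rewrite -[phi y - phi x](subrK ((y - x) *: m)) mulrDl.
  by apply: le_trans (nrD _ _) _; apply: lerD => //; rewrite nrZ mulrC.
have -> : f (phi y) - f (phi x) - (y - x) *: (m *: l) =
  (f (phi y) - f (phi x) - (phi y - phi x) *: l) +
  (phi y - phi x - (y - x) *: m) *: l.
  by move: (phi y - phi x) (y - x) => p q; rewrite scalerBl scalerA addrA subrK.
apply: le_trans (nrD _ _) _; rewrite nrZ.
have : e1 <= 1 by rewrite /e1 ge_min lexx.
have := nr_ge0 (y - x); have := nr_ge0 l; have := nr_ge0 m.
have := nr_ge0 (phi y - phi x).
set A := nr _ in h1 *; set B := nr _ in h2 *; set p := nr _; set M := nr m; set L := nr l; set q := nr _.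
rewrite -/p -/M -/q in h1 h2 hm.
move=> p0 M0 L0 q0 e11.
apply: (@le_trans _ _ (e1 * ((e1 + M) * q) + e1 * q * L)).
  apply: lerD; first by apply: le_trans h1 _; rewrite ler_pM2l.
  by rewrite ler_wpM2r.
apply: (@le_trans _ _ (e1 * (L + M + 1) * q)); last by rewrite ler_wpM2r.
have : e1 * q * e1 <= e1 * q * 1 by rewrite ler_wpM2l// mulr_ge0// ltW.
lra.
Qed.

End RealNorm.

(** * Integrals of complex-valued functions of a real variable *)

Section ComplexIntegral.
Context {R : realType}.
Notation mu := (@lebesgue_measure R).
Implicit Types (g h : R -> CC R) (f : CC R -> CC R) (a b c d m t s : R).

Definition rint (u : R -> R) a b : R := \int[mu]_(x in `[a, b]) u x.

Definition cint g a b : CC R :=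
  (rint (fun t => complex.Re (g t)) a b +i* rint (fun t => complex.Im (g t)) a b)%C.

Definition rcont (u : R -> R) a b := forall t, a <= t <= b -> {for t, continuous u}.
Definition ccont g a b := forall t, a <= t <= b -> {for t, continuous g}.

Lemma rcont_int u a b : rcont u a b -> mu.-integrable `[a, b] (EFin \o u).
Proof.
move=> cu; apply: continuous_compact_integrable; first exact: segment_compact.
apply: continuous_in_subspaceT => t /set_mem /=; rewrite in_itv /= => tab.
exact: cu.
Qed.

Lemma ccontRe g a b : ccont g a b -> rcont (fun t => complex.Re (g t)) a b.
Proof.
move=> cg t tab; apply/cvgrPdist_lt => e e0.
have /cont_nrP/(_ e e0) H := cg t tab.
apply: filterS H => s; apply: le_lt_trans; rewrite distrC.
by rewrite -raddfB; exact: Re_le_nr.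
Qed.

Lemma ccontIm g a b : ccont g a b -> rcont (fun t => complex.Im (g t)) a b.
Proof.
move=> cg t tab; apply/cvgrPdist_lt => e e0.
have /cont_nrP/(_ e e0) H := cg t tab.
apply: filterS H => s; apply: le_lt_trans; rewrite distrC.
by rewrite -raddfB; exact: Im_le_nr.
Qed.

Lemma rintD u v a b : rcont u a b -> rcont v a b ->
  rint (fun t => u t + v t) a b = rint u a b + rint v a b.
Proof. by move=> cu cv; apply: RintegralD => //; exact: rcont_int. Qed.

Lemma rintZ r u a b : rcont u a b -> rint (fun t => r * u t) a b = r * rint u a b.
Proof. by move=> cu; apply: RintegralZl => //; exact: rcont_int. Qed.

Lemma rint_cst r a b : a <= b -> rint (fun=> r) a b = r * (b - a).
Proof.
move=> ab; rewrite /rint Rintegral_cst//.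
have E : lebesgue_measure (`[a, b] : set R) = (b - a)%:E.
  rewrite (lebesgue_measure_itv `[a, b]) /= lte_fin.
  case: ltP => //= ba; have -> : b = a by lra.
  by rewrite subrr.
by congr (_ * _); rewrite [X in fine X]E.
Qed.

Lemma rint_cat u a m b : a <= m <= b -> rcont u a b ->
  rint u a b = rint u a m + rint u m b.
Proof.
move=> /andP[am mb] cu; have iu := rcont_int cu.
have := @Rintegral_itvB R u (BLeft a) (BRight b) m iu.
rewrite !bnd_simp => /(_ am mb) E; rewrite /rint; apply/eqP.
rewrite addrC -subr_eq E Rintegral_itv_obnd_cbnd//.
apply: integrableS iu => //; apply: subset_itvr.
by rewrite bnd_simp.
Qed.

Lemma le_rint u v a b : rcont u a b -> rcont v a b ->
  (forall t, a <= t <= b -> u t <= v t) -> rint u a b <= rint v a b.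
Proof.
move=> cu cv uv.
by apply: (le_Rintegral _ (rcont_int cu) (rcont_int cv)) => // t; exact: uv.
Qed.

Lemma rcont_cst r a b : rcont (fun=> r) a b.
Proof. by move=> t _; exact: cvg_cst. Qed.

Lemma rint_bound u a b r : a <= b -> rcont u a b ->
  (forall t, a <= t <= b -> `|u t| <= r) -> `|rint u a b| <= r * (b - a).
Proof.
move=> ab cu ub; rewrite ler_norml; apply/andP; split.
  rewrite -mulNr -rint_cst//; apply: le_rint => //; first exact: rcont_cst.
  by move=> t /ub; rewrite ler_norml => /andP[].
rewrite -rint_cst//; apply: le_rint => //; first exact: rcont_cst.
by move=> t /ub; rewrite ler_norml => /andP[].
Qed.

Lemma eq_cint g h a b : (forall t, a <= t <= b -> g t = h t) -> cint g a b = cint h a b.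
Proof.
move=> gh; rewrite /cint; congr Complex; apply: eq_Rintegral => t /set_mem /=;
  by rewrite in_itv /= => /gh ->.
Qed.

Lemma cintD g h a b : ccont g a b -> ccont h a b ->
  cint (fun t => g t + h t) a b = cint g a b + cint h a b.
Proof.
move=> cg ch; rewrite /cint.
under [X in rint X]eq_fun do rewrite raddfD.
under [X in (_ +i* rint X _ _)%C]eq_fun do rewrite raddfD.
rewrite !rintD//; do ?[exact: ccontRe | exact: ccontIm].
Qed.

Lemma cintZ k g a b : ccont g a b -> cint (fun t => k * g t) a b = k * cint g a b.
Proof.
move=> cg; have cR := ccontRe cg; have cI := ccontIm cg.
have cMl r u : rcont u a b -> rcont (fun t => r * u t) a b.
  by move=> cu t tab; apply: cvgM; [exact: cvg_cst | exact: cu].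
case: k => p q; rewrite /cint.
have -> : (fun t => complex.Re ((p +i* q)%C * g t)) =
   (fun t => p * complex.Re (g t) + (- q) * complex.Im (g t)).
  by apply/funext => t; case: (g t) => u v /=; rewrite mulNr.
have -> : (fun t => complex.Im ((p +i* q)%C * g t)) =
   (fun t => p * complex.Im (g t) + q * complex.Re (g t)).
  by apply/funext => t; case: (g t) => u v /=.
rewrite !rintD ?rintZ//; do ?exact: cMl.
by rewrite mulNr.
Qed.

Lemma cint_cst (k : CC R) a b : a <= b -> cint (fun=> k) a b = k * toCC (b - a).
Proof.
move=> ab; rewrite /cint !rint_cst//; case: k => p q.
by apply/eqP; rewrite eq_complex /= !mulr0 !subr0 add0r !eqxx.
Qed.

Lemma cint_cat g a m b : a <= m <= b -> ccont g a b ->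
  cint g a b = cint g a m + cint g m b.
Proof.
move=> amb cg; rewrite /cint (rint_cat amb (ccontRe cg)) (rint_cat amb (ccontIm cg)).
by [].
Qed.

Lemma cint_bound g a b r : a <= b -> ccont g a b ->
  (forall t, a <= t <= b -> nr (g t) <= r) -> nr (cint g a b) <= 2 * r * (b - a).
Proof.
move=> ab cg gr; apply: le_trans (nr_le_ReIm _) _.
rewrite -mulrA mulr_natl mulr2n; apply: lerD => /=; apply: rint_bound => //.
- exact: ccontRe.
- by move=> t tab; apply: le_trans (Re_le_nr _) (gr t tab).
- exact: ccontIm.
- by move=> t tab; apply: le_trans (Im_le_nr _) (gr t tab).
Qed.

End ComplexIntegral.

(** * Goursat's theorem on rectangles *)

Section Goursat.
Context {R : realType}.
Implicit Types (f g : CC R -> CC R) (a b c d m t s e r : R) (P : CC R -> Prop).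

Definition pt t s : CC R := (t +i* s)%C.

Lemma ptB t s t' s' : pt t s - pt t' s' = pt (t - t') (s - s').
Proof. by []. Qed.

Lemma nr_pt t s : nr (pt t s) <= `|t| + `|s|.
Proof. exact: nr_le_ReIm. Qed.

Lemma nr_ptx t : nr (pt t 0) = `|t|.
Proof. exact: nr_toCC. Qed.

Lemma nr_pty s : nr (pt 0 s) = `|s|.
Proof.
apply/eqP; rewrite eq_le; apply/andP; split; last exact: Im_le_nr (pt 0 s).
by apply: le_trans (nr_pt _ _) _; rewrite normr0 add0r.
Qed.

Lemma ptE (w : CC R) : w = pt (complex.Re w) (complex.Im w).
Proof. by case: w. Qed.

Definition on_rect a b c d P :=
  forall t s, a <= t <= b -> c <= s <= d -> P (pt t s).

Definition on_edges a b c d P :=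
  (forall t, a <= t <= b -> P (pt t c) /\ P (pt t d)) /\
  (forall s, c <= s <= d -> P (pt a s) /\ P (pt b s)).

Lemma rect_edges a b c d P : a <= b -> c <= d ->
  on_rect a b c d P -> on_edges a b c d P.
Proof.
move=> ab cd H; split=> [t tab|s scd]; split; apply: H => //;
  by rewrite ?lexx ?ab ?cd.
Qed.

Lemma edges_impl a b c d P Q : (forall w, P w -> Q w) ->
  on_edges a b c d P -> on_edges a b c d Q.
Proof.
by move=> PQ [H1 H2]; split=> [t /H1[]|s /H2[]] p q; split; exact: PQ.
Qed.

Lemma edges_and a b c d P Q :
  on_edges a b c d P -> on_edges a b c d Q -> on_edges a b c d (fun w => P w /\ Q w).
Proof.
move=> [P1 P2] [Q1 Q2]; split=> [t tt|s ss].
  by have [? ?] := P1 t tt; have [? ?] := Q1 t tt.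
by have [? ?] := P2 s ss; have [? ?] := Q2 s ss.
Qed.

(** The contour integral over the positively oriented boundary of
    [[a, b] x [c, d]]; opposite sides are paired so that only integrals over
    increasing segments occur. *)
Definition bint f a b c d : CC R :=
  cint (fun t => f (pt t c) - f (pt t d)) a b +
  pt 0 1 * cint (fun s => f (pt b s) - f (pt a s)) c d.

Definition cont_at f w := {for w, continuous f}.

Lemma cont_atD f g w : cont_at f w -> cont_at g w -> cont_at (fun v => f v + g v) w.
Proof. by move=> cf cg; exact: (cvgD cf cg). Qed.

Lemma cont_atM f g w : cont_at f w -> cont_at g w -> cont_at (fun v => f v * g v) w.
Proof. by move=> cf cg; exact: (cvgM cf cg). Qed.

Lemma cont_atZ (k : CC R) f w : cont_at f w -> cont_at (fun v => k * f v) w.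
Proof. by move=> cf; apply: (cvgM _ cf); exact: cvg_cst. Qed.

Lemma cont_at_hor f t s : cont_at f (pt t s) -> {for t, continuous (fun x => f (pt x s))}.
Proof.
move=> /cont_nrP fc; apply/cont_nrP => e /fc/(iffLR (nbhs_nrP _ _))[dl dl0 H].
apply/nbhs_ballP; exists dl => // x; rewrite /ball /= => xt.
by apply: H; rewrite ptB subrr nr_ptx distrC.
Qed.

Lemma cont_at_ver f t s : cont_at f (pt t s) -> {for s, continuous (fun x => f (pt t x))}.
Proof.
move=> /cont_nrP fc; apply/cont_nrP => e /fc/(iffLR (nbhs_nrP _ _))[dl dl0 H].
apply/nbhs_ballP; exists dl => // x; rewrite /ball /= => xt.
by apply: H; rewrite ptB subrr nr_pty distrC.
Qed.

Lemma ccontB (g h : R -> CC R) a b : ccont g a b -> ccont h a b ->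
  ccont (fun t => g t - h t) a b.
Proof. by move=> cg ch t tab; apply: cvgB; [exact: cg|exact: ch]. Qed.

Lemma ccontZ k (g : R -> CC R) a b : ccont g a b -> ccont (fun t => k * g t) a b.
Proof. by move=> cg t tab; apply: cvgM; [exact: cvg_cst|exact: cg]. Qed.

Lemma edges_hor f a b c d : on_edges a b c d (cont_at f) ->
  ccont (fun t => f (pt t c) - f (pt t d)) a b.
Proof.
move=> [H _]; apply: ccontB => t /H[h1 h2]; exact: cont_at_hor.
Qed.

Lemma edges_ver f a b c d : on_edges a b c d (cont_at f) ->
  ccont (fun s => f (pt b s) - f (pt a s)) c d.
Proof.
move=> [_ H]; apply: ccontB => t /H[h1 h2]; exact: cont_at_ver.
Qed.

Lemma eq_bint f g a b c d : on_edges a b c d (fun w => f w = g w) ->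
  bint f a b c d = bint g a b c d.
Proof.
move=> [H1 H2]; congr (_ + _ * _); apply: eq_cint.
  by move=> t /H1[-> ->].
by move=> t /H2[-> ->].
Qed.

Lemma bint_lin f g k a b c d : on_edges a b c d (cont_at f) -> on_edges a b c d (cont_at g) ->
  bint (fun w => f w + k * g w) a b c d = bint f a b c d + k * bint g a b c d.
Proof.
move=> cf cg; have [fh fv] := (edges_hor cf, edges_ver cf).
have [gh gv] := (edges_hor cg, edges_ver cg).
rewrite /bint.
rewrite (@eq_cint _ _ (fun t => (f (pt t c) - f (pt t d)) + k * (g (pt t c) - g (pt t d)))); last first.
  by move=> t _; ring.
rewrite [X in _ + _ * X](@eq_cint _ _ (fun s => (f (pt b s) - f (pt a s)) + k * (g (pt b s) - g (pt a s)))); last first.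
  by move=> t _; ring.
have kgh := ccontZ (k := k) gh; have kgv := ccontZ (k := k) gv.
rewrite (cintD fh kgh) (cintD fv kgv) (cintZ k gh) (cintZ k gv).
by ring.
Qed.

Lemma bint_bound f r a b c d : a <= b -> c <= d -> on_edges a b c d (cont_at f) ->
  on_edges a b c d (fun w => nr (f w) <= r) ->
  nr (bint f a b c d) <= 4 * r * ((b - a) + (d - c)).
Proof.
move=> ab cd cf [b1 b2]; apply: le_trans (nrD _ _) _.
rewrite nrM nr_pty normr1 mul1r mulrDr.
have -> : 4 * r = 2 * (2 * r) by lra.
apply: lerD.
  apply: (cint_bound ab (edges_hor cf)) => t /b1[h1 h2].
  by apply: le_trans (nrB _ _) _; lra.
apply: (cint_bound cd (edges_ver cf)) => t /b2[h1 h2].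
by apply: le_trans (nrB _ _) _; lra.
Qed.

Lemma cdiff_affine p q w : cdiff (fun w : CC R => p + q * w) w q.
Proof.
move=> e e0; exists 1 => // y _.
have -> : p + q * y - (p + q * w) - (y - w) *: q = 0.
  by rewrite -[(y - w) *: q]/((y - w) * q); ring.
by rewrite nr0 mulr_ge0 ?nr_ge0 ?ltW.
Qed.

Lemma cont_at_affine p q w : cont_at (fun w : CC R => p + q * w) w.
Proof. exact: cdiff_cont (cdiff_affine p q w). Qed.

Lemma edges_all P a b c d : (forall w, P w) -> on_edges a b c d P.
Proof. by move=> H; split. Qed.

Lemma bint_affine p q a b c d : a <= b -> c <= d ->
  bint (fun w => p + q * w) a b c d = 0.
Proof.
move=> ab cd; rewrite /bint.
rewrite (@eq_cint _ _ (fun t => q * pt 0 (c - d))); last first.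
  move=> t _; have -> : pt 0 (c - d) = pt t c - pt t d by rewrite ptB subrr.
  by ring.
rewrite [X in _ + _ * X](@eq_cint _ _ (fun t => q * pt (b - a) 0)); last first.
  move=> t _; have -> : pt (b - a) 0 = pt b t - pt a t by rewrite ptB subrr.
  by ring.
rewrite !cint_cst//.
have -> : pt 0 (c - d) = - (pt 0 1 * toCC (d - c)).
  by apply/eqP; rewrite eq_complex /=; apply/andP; split; apply/eqP; ring.
have -> : toCC (b - a) = pt (b - a) 0 by [].
by ring.
Qed.

Lemma bint_cut_x f a m b c d : a <= m <= b -> c <= d ->
  on_edges a b c d (cont_at f) -> (forall s, c <= s <= d -> cont_at f (pt m s)) ->
  bint f a b c d = bint f a m c d + bint f m b c d.
Proof.
move=> amb cd cf cm; have fh := edges_hor cf.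
rewrite /bint (cint_cat amb fh).
have [_ cv] := cf.
have ca : ccont (fun s => f (pt a s)) c d by move=> s /cv[? ?]; exact: cont_at_ver.
have cb : ccont (fun s => f (pt b s)) c d by move=> s /cv[? ?]; exact: cont_at_ver.
have cmm : ccont (fun s => f (pt m s)) c d by move=> s /cm ?; exact: cont_at_ver.
rewrite (@eq_cint _ (fun s => f (pt b s) - f (pt a s)) (fun s => (f (pt m s) - f (pt a s)) + (f (pt b s) - f (pt m s)))); last first.
  by move=> t _; ring.
rewrite (cintD (ccontB cmm ca) (ccontB cb cmm)).
by ring.
Qed.

Lemma bint_cut_y f a b c m d : a <= b -> c <= m <= d ->
  on_edges a b c d (cont_at f) -> (forall t, a <= t <= b -> cont_at f (pt t m)) ->
  bint f a b c d = bint f a b c m + bint f a b m d.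
Proof.
move=> ab cmd cf cm; have fv := edges_ver cf.
rewrite /bint (cint_cat cmd fv).
have [ch _] := cf.
have cc : ccont (fun s => f (pt s c)) a b by move=> s /ch[? ?]; exact: cont_at_hor.
have cdd : ccont (fun s => f (pt s d)) a b by move=> s /ch[? ?]; exact: cont_at_hor.
have cmm : ccont (fun s => f (pt s m)) a b by move=> s /cm ?; exact: cont_at_hor.
rewrite (@eq_cint _ (fun s => f (pt s c) - f (pt s d)) (fun s => (f (pt s c) - f (pt s m)) + (f (pt s m) - f (pt s d)))); last first.
  by move=> t _; ring.
rewrite (cintD (ccontB cc cmm) (ccontB cmm cdd)).
by ring.
Qed.

Lemma on_rect_sub a b c d a' b' c' d' P : a <= a' -> b' <= b -> c <= c' -> d' <= d ->
  on_rect a b c d P -> on_rect a' b' c' d' P.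
Proof.
by move=> aa bb cc dd H t s /andP[? ?] /andP[? ?]; apply: H; apply/andP; split; lra.
Qed.

Definition cderivable f w := exists l, cdiff f w l.

Lemma cderivable_cont f w : cderivable f w -> cont_at f w.
Proof. by move=> [l]; exact: cdiff_cont. Qed.

Lemma dist_segment (u v x y : R) : u <= x <= u + v -> u <= y <= u + v -> `|x - y| <= v.
Proof. by move=> /andP[? ?] /andP[? ?]; rewrite ler_norml; apply/andP; split; lra. Qed.

Lemma nested_point (u : nat -> R) (h : R) : 0 <= h ->
  (forall n, u n <= u n.+1 /\ u n.+1 + h / 2 ^+ n.+1 <= u n + h / 2 ^+ n) ->
  exists x, forall n, u n <= x <= u n + h / 2 ^+ n.
Proof.
move=> h0 H.
have hn n : 0 <= h / 2 ^+ n by rewrite divr_ge0// exprn_ge0.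
have up n k : u n <= u (n + k)%N /\ u (n + k)%N + h / 2 ^+ (n + k) <= u n + h / 2 ^+ n.
  elim: k => [|k [IH1 IH2]]; first by rewrite addn0 !lexx.
  rewrite addnS; have [h1 h2] := H (n + k)%N; split.
    exact: le_trans IH1 h1.
  exact: le_trans h2 IH2.
have ub (n m : nat) : u m <= u n + h / 2 ^+ n.
  have [mn|/ltnW nm] := leqP m n.
    have [h1 _] := up m (n - m)%N; rewrite subnKC// in h1.
    by apply: le_trans h1 _; rewrite lerDl.
  have [_ h1] := up n (m - n)%N; rewrite subnKC// in h1.
  by apply: le_trans h1; rewrite lerDl.
have hs : has_sup (range u).
  split; first by exists (u 0%N), 0%N.
  by exists (u 0%N + h / 2 ^+ 0) => _ [m _ <-]; exact: ub.
exists (sup (range u)) => n; apply/andP; split.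
  by apply: ub_le_sup; [case: hs|exists n].
by apply: ge_sup; [case: hs|move=> _ [m _ <-]; exact: ub].
Qed.

Lemma bint_quarter f a b c d : a <= b -> c <= d -> on_rect a b c d (cont_at f) ->
  exists a' c', [/\ a <= a', a' + (b - a) / 2 <= b, c <= c', c' + (d - c) / 2 <= d &
    nr (bint f a b c d) <= 4 * nr (bint f a' (a' + (b - a) / 2) c' (c' + (d - c) / 2))].
Proof.
move=> ab cd cf; set m := a + (b - a) / 2; set m' := c + (d - c) / 2.
have am : a <= m by rewrite /m; lra.
have mb : m <= b by rewrite /m; lra.
have cm : c <= m' by rewrite /m'; lra.
have md : m' <= d by rewrite /m'; lra.
have mE : m + (b - a) / 2 = b by rewrite /m; lra.
have mE' : m' + (d - c) / 2 = d by rewrite /m'; lra.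
have e0 := rect_edges ab cd cf.
have c1 : on_rect a m c d (cont_at f) by exact: on_rect_sub cf.
have c2 : on_rect m b c d (cont_at f) by exact: on_rect_sub cf.
have e1 := rect_edges am cd c1; have e2 := rect_edges mb cd c2.
have E : bint f a b c d =
   (bint f a m c m' + bint f a m m' d) + (bint f m b c m' + bint f m b m' d).
  rewrite (@bint_cut_x f a m b c d) ?am//; last first.
    by move=> s scd; apply: cf; rewrite ?am.
  congr (_ + _); (rewrite (@bint_cut_y f _ _ c m' d) ?cm// => t /andP[t1 t2]).
    by apply: cf; rewrite ?cm//; apply/andP; split => //; lra.
  by apply: cf; rewrite ?cm//; apply/andP; split => //; lra.
pose T := nr (bint f a b c d) / 4.
have : [\/ T <= nr (bint f a m c m'), T <= nr (bint f a m m' d),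
    T <= nr (bint f m b c m') | T <= nr (bint f m b m' d)].
  apply: contrapT => H.
  have h1 : nr (bint f a m c m') < T by rewrite ltNge; apply/negP => h; apply: H; constructor 1.
  have h2 : nr (bint f a m m' d) < T by rewrite ltNge; apply/negP => h; apply: H; constructor 2.
  have h3 : nr (bint f m b c m') < T by rewrite ltNge; apply/negP => h; apply: H; constructor 3.
  have h4 : nr (bint f m b m' d) < T by rewrite ltNge; apply/negP => h; apply: H; constructor 4.
  have : nr (bint f a b c d) < (T + T) + (T + T).
    rewrite E; apply: le_lt_trans (nrD _ _) _.
    by apply: ltrD; apply: le_lt_trans (nrD _ _) (ltrD _ _).
  by have -> : (T + T) + (T + T) = nr (bint f a b c d); [rewrite /T; field|rewrite ltxx].
rewrite /T => -[] h.
- by exists a, c; rewrite -/m -/m'; split => //; lra.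
- by exists a, m'; rewrite -/m mE'; split => //; lra.
- by exists m, c; rewrite mE -/m'; split => //; lra.
- by exists m, m'; rewrite mE mE'; split => //; lra.
Qed.

(** Bisection: were the integral nonzero, one quarter would carry at least a
    fourth of it, and iterating this contradicts differentiability at the limit
    point, where the integrand is affine up to a small multiple of the
    distance. *)
Lemma goursat f a b c d : a <= b -> c <= d -> on_rect a b c d (cderivable f) ->
  bint f a b c d = 0.
Proof.
move=> ab cd df.
have cf : on_rect a b c d (cont_at f) by move=> t s tab scd; exact: cderivable_cont (df t s tab scd).
pose w := b - a; pose h := d - c.
have w0 : 0 <= w by rewrite subr_ge0.
have h0 : 0 <= h by rewrite subr_ge0.
pose J (n : nat) (p : R * R) := bint f p.1 (p.1 + w / 2 ^+ n) p.2 (p.2 + h / 2 ^+ n).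
pose I0 := nr (bint f a b c d).
pose Q n (p : R * R) := [/\ a <= p.1, p.1 + w / 2 ^+ n <= b, c <= p.2,
   p.2 + h / 2 ^+ n <= d & I0 <= 4 ^+ n * nr (J n p)].
pose St n (p q : R * R) := [/\ p.1 <= q.1, q.1 + w / 2 ^+ n.+1 <= p.1 + w / 2 ^+ n,
   p.2 <= q.2, q.2 + h / 2 ^+ n.+1 <= p.2 + h / 2 ^+ n & Q n.+1 q].
have wn n : 0 <= w / 2 ^+ n by rewrite divr_ge0// exprn_ge0.
have hn n : 0 <= h / 2 ^+ n by rewrite divr_ge0// exprn_ge0.
have half (x : R) n : x / 2 ^+ n / 2 = x / 2 ^+ n.+1 by rewrite exprSr invfM mulrA.
have step n p : Q n p -> exists q, St n p q.
  case: p => p1 p2 [/= q1 q2 q3 q4 q5].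
  have l1 : p1 <= p1 + w / 2 ^+ n by rewrite lerDl.
  have l2 : p2 <= p2 + h / 2 ^+ n by rewrite lerDl.
  have [|a' [c' []]] := @bint_quarter f _ _ _ _ l1 l2.
    exact: on_rect_sub cf.
  rewrite ![_ + _ - _]addrC !addKr !half => r1 r2 r3 r4 r5.
  exists (a', c'); split => //; split => /=; [exact: le_trans r1|exact: le_trans q2|
    exact: le_trans r3|exact: le_trans q4|].
  apply: le_trans q5 _; rewrite exprSr -mulrA ler_pM2l ?exprn_gt0//.
pose st n p := xget p [set q | St n p q].
pose u := fix u n := if n is n'.+1 then st n' (u n') else (a, c).
have bE : a + w = b by rewrite /w addrC subrK.
have dE : c + h = d by rewrite /h addrC subrK.
have uQ n : Q n (u n).
  elim: n => [|n IH] /=.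
    by split => //=; rewrite /J /= expr0 ?divr1 ?mul1r ?bE ?dE.
  by have [q Hq] := step n _ IH; have [] := xgetPex (u n) (ex_intro _ q Hq).
have uS n : St n (u n) (u n.+1).
  by have [q Hq] := step n _ (uQ n); apply: (@xgetPex _ (u n) [set q | St n (u n) q]); exists q.
have [x Hx] := @nested_point (fun n => (u n).1) w w0
  (fun n => let: And5 A B _ _ _ := uS n in conj A B).
have [y Hy] := @nested_point (fun n => (u n).2) h h0
  (fun n => let: And5 _ _ A B _ := uS n in conj A B).
have xab : a <= x <= b.
  have := Hx 0%N; have [h1 h2 _ _ _] := uQ 0%N.
  by move=> /andP[h3 h4]; apply/andP; split; [exact: le_trans h3|exact: le_trans h4 _].
have ycd : c <= y <= d.
  have := Hy 0%N; have [_ _ h1 h2 _] := uQ 0%N.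
  by move=> /andP[h3 h4]; apply/andP; split; [exact: le_trans h3|exact: le_trans h4 _].
have [l fl] := df x y xab ycd.
pose S := w + h.
have S0 : 0 <= S by rewrite addr_ge0.
have small e : 0 < e -> I0 <= 4 * e * S * S.
  move=> e0; have [dl dl0 H] := fl e e0.
  have [n nS] : exists n, S / 2 ^+ n < dl.
    exists (Num.bound (S / dl)).
    rewrite ltr_pdivrMr ?exprn_gt0// mulrC -ltr_pdivrMr//.
    apply: lt_le_trans (archi_boundP _) _; first by rewrite divr_ge0// ltW.
    by rewrite -natrX ler_nat ltnW// ltn_expl.
  have [q1 q2 q3 q4 q5] := uQ n.
  apply: le_trans q5 _; rewrite /J.
  set p1 := (u n).1 in q1 q2 *; set p2 := (u n).2 in q3 q4 *.
  have l1 : p1 <= p1 + w / 2 ^+ n by rewrite lerDl.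
  have l2 : p2 <= p2 + h / 2 ^+ n by rewrite lerDl.
  have cr : on_rect p1 (p1 + w / 2 ^+ n) p2 (p2 + h / 2 ^+ n) (cont_at f).
    exact: on_rect_sub cf.
  pose z := pt x y.
  pose r v := f v + (-1) * (f z - l * z + l * v).
  have ca := edges_all (p1) (p1 + w / 2 ^+ n) p2 (p2 + h / 2 ^+ n) (@cont_at_affine (f z - l * z) l).
  have ce := rect_edges l1 l2 cr.
  have E : bint f p1 (p1 + w / 2 ^+ n) p2 (p2 + h / 2 ^+ n) =
           bint r p1 (p1 + w / 2 ^+ n) p2 (p2 + h / 2 ^+ n).
    by rewrite (bint_lin (-1) ce ca) bint_affine// mulr0 addr0.
  rewrite E.
  have ctr v : cont_at f v -> cont_at r v.
    move=> fv; have ca' := @cont_atZ (-1) _ v (@cont_at_affine (f z - l * z) l v).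
    exact: (@cont_atD f _ v fv ca').
  have rb : on_edges p1 (p1 + w / 2 ^+ n) p2 (p2 + h / 2 ^+ n)
      (fun v => nr (r v) <= e * (S / 2 ^+ n)).
    apply: rect_edges => // t s tt ss.
    have vz : nr (pt t s - z) <= S / 2 ^+ n.
      apply: le_trans (nr_pt _ _) _; rewrite /S mulrDl.
      exact: lerD (dist_segment tt (Hx n)) (dist_segment ss (Hy n)).
    have -> : r (pt t s) = f (pt t s) - f z - (pt t s - z) *: l.
      by rewrite /r -[(_ - _) *: l]/((_ - _) * l); ring.
    apply: le_trans (H _ _) _; first exact: le_lt_trans nS.
    by rewrite ler_pM2l.
  have := bint_bound l1 l2 (edges_impl ctr ce) rb.
  rewrite ![_ + _ - _]addrC !addKr -mulrDl -/S => B.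
  apply: (@le_trans _ _ (4 ^+ n * (4 * (e * (S / 2 ^+ n)) * (S / 2 ^+ n)))).
    by rewrite ler_pM2l ?exprn_gt0.
  have -> : 4 ^+ n = 2 ^+ n * 2 ^+ n :> R by rewrite -exprMn; congr (_ ^+ _); lra.
  rewrite le_eqVlt; apply/orP; left; apply/eqP; field.
  by rewrite expf_neq0.
apply/eqP; rewrite -nr_eq0 -/I0 eq_le nr_ge0 andbT.
apply/ler_addgt0Pl => e e0; rewrite addr0.
have K0 : 0 < 4 * S * S + 1 by rewrite ltr_wpDl// !mulr_ge0.
apply: le_trans (small (e / (4 * S * S + 1)) _) _; first by rewrite divr_gt0.
have -> : 4 * (e / (4 * S * S + 1)) * S * S = e * ((4 * S * S) / (4 * S * S + 1)).
  by field; lra.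
by rewrite ger_pMr// ler_pdivrMr// mul1r lerDl.
Qed.

End Goursat.

(** * Cauchy's formula on rectangles *)

Section CauchyKernel.
Context {R : realType}.
Implicit Types (f g : CC R -> CC R) (a b c d m t s e r x y : R).

Lemma cdiff_near f g (w l : CC R) r : 0 < r ->
  (forall v, nr (v - w) < r -> f v = g v) -> cdiff f w l -> cdiff g w l.
Proof.
move=> r0 fg fl e e0; have [dl dl0 H] := fl e e0.
exists (Num.min dl r); first by rewrite lt_min dl0.
move=> v; rewrite lt_min => /andP[vd vr]; rewrite -!fg//; first exact: H.
by rewrite subrr nr0.
Qed.

Lemma cderivableM f g w : cderivable f w -> cderivable g w ->
  cderivable (fun v => f v * g v) w.
Proof.
move=> /cdiff_derivable df /cdiff_derivable dg; apply/cdiff_derivable.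
exact: (@derivableM (CC R) (CC R) f g w 1 df dg).
Qed.

Lemma cderivableV f w : f w != 0 -> cderivable f w -> cderivable (fun v => (f v)^-1) w.
Proof.
move=> f0 /cdiff_derivable df; apply/cdiff_derivable.
exact: (@derivableV (CC R) (CC R) f w 1 f0 df).
Qed.

Lemma cderivable_affine (p q w : CC R) : cderivable (fun v => p + q * v) w.
Proof. by exists q; exact: cdiff_affine. Qed.

Lemma cderivable_subC f (p w : CC R) : cderivable f w -> cderivable (fun v => f v - p) w.
Proof.
move=> [l fl]; exists l => e e0; have [dl dl0 H] := fl e e0; exists dl => // v vd.
by rewrite [X in nr (X - _)](_ : _ = f v - f w); [exact: H|ring].
Qed.

Lemma cderivable_kernel (z w : CC R) : w != z -> cderivable (fun v => (v - z)^-1) w.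
Proof.
move=> wz; apply: cderivableV; first by rewrite subr_eq0.
by exists 1 => e e0; exists 1 => // v _;
  rewrite [X in nr X](_ : _ = 0) ?nr0 ?mulr_ge0 ?nr_ge0 ?ltW// -[_ *: 1]/(_ * 1); ring.
Qed.

(** Cutting along the four sides of a small square around the exceptional point
    leaves only that square, and its boundary integral is bounded by its
    perimeter. *)
Lemma goursat_punctured f a b c d x y : a < x < b -> c < y < d ->
  on_rect a b c d (cont_at f) ->
  on_rect a b c d (fun w => w != pt x y -> cderivable f w) ->
  bint f a b c d = 0.
Proof.
move=> /andP[ax xb] /andP[cy yd] cf df.
have cz : cont_at f (pt x y) by apply: cf; rewrite !ltW.
have /cont_nrP/(_ 1 ltr01)/(iffLR (nbhs_nrP _ _))[dl dl0 near_z] := cz.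
pose M := nr (f (pt x y)) + 1.
have M0 : 0 < M by rewrite ltr_wpDl ?nr_ge0.
have small e : 0 < e -> e < x - a -> e < b - x -> e < y - c -> e < d - y -> e + e < dl ->
    nr (bint f a b c d) <= 16 * M * e.
  move=> e0 e1 e2 e3 e4 e5.
  have D a' b' c' d' : a <= a' -> b' <= b -> c <= c' -> d' <= d ->
      (b' < x \/ x < a' \/ d' < y \/ y < c') -> a' <= b' -> c' <= d' ->
      bint f a' b' c' d' = 0.
    move=> h1 h2 h3 h4 h5 h6 h7; apply: goursat => // t s /andP[t1 t2] /andP[s1 s2].
    apply: df; [by apply/andP; split; lra..|].
    apply/negP => /eqP [tx sy]; case: h5 => [|[|[|]]]; lra.
  have cE t s : a <= t <= b -> c <= s <= d -> cont_at f (pt t s) by exact: cf.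
  rewrite (@bint_cut_x _ f a (x - e) b c d); last 4 first.
  - by apply/andP; split; lra.
  - by lra.
  - by apply: rect_edges => //; lra.
  - by move=> s ss; apply: cE => //; apply/andP; split; lra.
  rewrite (@bint_cut_x _ f (x - e) (x + e) b c d); last 4 first.
  - by apply/andP; split; lra.
  - by lra.
  - by apply: rect_edges; [lra|lra|apply: on_rect_sub cf; lra].
  - by move=> s ss; apply: cE => //; apply/andP; split; lra.
  rewrite (@bint_cut_y _ f (x - e) (x + e) c (y - e) d); last 4 first.
  - by lra.
  - by apply/andP; split; lra.
  - by apply: rect_edges; [lra|lra|apply: on_rect_sub cf; lra].
  - by move=> t /andP[t1 t2]; apply: cE; apply/andP; split; lra.
  rewrite (@bint_cut_y _ f (x - e) (x + e) (y - e) (y + e) d); last 4 first.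
  - by lra.
  - by apply/andP; split; lra.
  - by apply: rect_edges; [lra|lra|apply: on_rect_sub cf; lra].
  - by move=> t /andP[t1 t2]; apply: cE; apply/andP; split; lra.
  have -> : bint f a (x - e) c d = 0 by apply: D; lra.
  have -> : bint f (x + e) b c d = 0 by apply: D; lra.
  have -> : bint f (x - e) (x + e) c (y - e) = 0 by apply: D; lra.
  have -> : bint f (x - e) (x + e) (y + e) d = 0 by apply: D; lra.
  rewrite !add0r !addr0.
  have -> : 16 * M * e = 4 * M * ((x + e - (x - e)) + (y + e - (y - e))) by ring.
  apply: bint_bound; [lra|lra| |].
    by apply: rect_edges; [lra|lra|apply: on_rect_sub cf; lra].
  apply: rect_edges; [lra|lra|] => t s /andP[t1 t2] /andP[s1 s2].
  have /= : nr (f (pt t s) - f (pt x y)) < 1.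
    apply: near_z; rewrite ptB; apply: le_lt_trans (nr_pt _ _) _.
    by apply: le_lt_trans e5; apply: lerD; rewrite ler_norml; apply/andP; split; lra.
  by have := nr_tri (f (pt x y)) (f (pt t s)) 0; rewrite !subr0 /M; lra.
apply/eqP; rewrite -nr_eq0 eq_le nr_ge0 andbT.
apply/ler_addgt0Pl => e e0; rewrite addr0.
pose e' := Num.min (Num.min (Num.min (x - a) (b - x)) (Num.min (y - c) (d - y)))
   (Num.min (dl / 2) (e / (8 * M))).
have e'0 : 0 < e'.
  rewrite !lt_min !subr_gt0 ax xb cy yd /=; apply/andP; split; first exact: divr_gt0.
  by apply: divr_gt0 => //; exact: mulr_gt0.
have : e' <= x - a by rewrite /e' !ge_min lexx.
have : e' <= b - x by rewrite /e' !ge_min lexx !orbT.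
have : e' <= y - c by rewrite /e' !ge_min lexx !orbT.
have : e' <= d - y by rewrite /e' !ge_min lexx !orbT.
have : e' <= dl / 2 by rewrite /e' !ge_min lexx !orbT.
have : e' <= e / (8 * M) by rewrite /e' !ge_min lexx !orbT.
rewrite ler_pdivlMr ?mulr_gt0// => k1 k2 k3 k4 k5 k6.
by apply: le_trans (small (e' / 2) _ _ _ _ _ _) _; lra.
Qed.

(** The difference quotient [(f w - f z) / (w - z)] is continuous at [z] and
    differentiable elsewhere. The winding integral of the kernel is left
    unevaluated: a lower bound for its modulus is all that the Lipschitz
    estimate below needs. *)
Lemma cauchy_formula f a b c d x y : a < x < b -> c < y < d ->
  on_rect a b c d (cderivable f) ->
  bint (fun w => f w * (w - pt x y)^-1) a b c d =
  f (pt x y) * bint (fun w => (w - pt x y)^-1) a b c d.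
Proof.
move=> xab ycd df; set z := pt x y.
have [/andP[ax xb] /andP[cy yd]] := (xab, ycd).
have ab : a <= b by lra. have cd : c <= d by lra.
have [l fl] : cderivable f z by apply: df; rewrite !ltW.
pose g w := if w == z then l else (f w - f z) * (w - z)^-1.
have edge : on_edges a b c d (fun w => w != z).
  by split => [t tt|s ss]; split; apply/negP => /eqP[]; lra.
have dg w : w != z -> cderivable f w -> cderivable g w.
  move=> wz dfw.
  have [l' gl'] := cderivableM (cderivable_subC (f z) dfw) (cderivable_kernel wz).
  exists l'; apply: (@cdiff_near _ _ _ _ (nr (w - z)) _ _ gl').
    by rewrite nr_gt0 subr_eq0.
  move=> v vw; rewrite /g; case: eqVneq => // vz.
  by move: vw; rewrite vz nr_sym ltxx.
have cg : on_rect a b c d (cont_at g).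
  move=> t s tt ss; have [ez|nz] := eqVneq (pt t s) z; last first.
    by apply: cderivable_cont; apply: dg => //; exact: df.
  rewrite ez; apply/cont_nrP => e e0; have [dl dl0 H] := fl (e / 2) (divr_gt0 e0 (ltr0Sn _ _)).
  apply/nbhs_nrP; exists dl => // v vz; rewrite /= /g eqxx.
  case: eqVneq => [_|vNz]; first by rewrite subrr nr0.
  have v0 : v - z != 0 by rewrite subr_eq0.
  have -> : (f v - f z) * (v - z)^-1 - l = (f v - f z - (v - z) *: l) * (v - z)^-1.
    by rewrite -[(v - z) *: l]/((v - z) * l); field.
  rewrite nrM nrV -lter_pdivlMr ?invr_gt0 ?nr_gt0// invrK.
  apply: le_lt_trans (H v vz) _; rewrite ltr_pM2r ?nr_gt0//.
  by rewrite gtr_pMr// invf_lt1// ltr1n.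
have : bint g a b c d = 0.
  apply: (goursat_punctured xab ycd cg) => t s tt ss nz; apply: dg => //; exact: df.
have ce : on_edges a b c d (cont_at (fun w => (w - z)^-1)).
  apply: edges_impl edge => w wz; apply: cderivable_cont; exact: cderivable_kernel.
have cf : on_edges a b c d (cont_at (fun w => f w * (w - z)^-1)).
  have := edges_and (rect_edges ab cd df) ce; apply: edges_impl => w [dw cw].
  exact: (cont_atM (cderivable_cont dw) cw).
have -> : bint g a b c d = bint (fun w => f w * (w - z)^-1 + (- f z) * (w - z)^-1) a b c d.
  apply: eq_bint; apply: edges_impl edge => w wz.
  by rewrite /g (negbTE wz) mulrBl mulNr.
by rewrite (bint_lin (- f z) cf ce) mulNr => /eqP; rewrite subr_eq0 => /eqP.
Qed.

End CauchyKernel.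

(** * Local Lipschitz bounds for holomorphic functions *)

Section HolomorphicLipschitz.
Context {R : realType}.
Implicit Types (f g : CC R -> CC R) (a b c d m t s e r x y al : R).

Lemma ReB (v w : CC R) : complex.Re (v - w) = complex.Re v - complex.Re w.
Proof. by case: v w => ? ? []. Qed.

Lemma ImB (v w : CC R) : complex.Im (v - w) = complex.Im v - complex.Im w.
Proof. by case: v w => ? ? []. Qed.

Lemma Re_inv t s : complex.Re (pt t s)^-1 = t / (t ^+ 2 + s ^+ 2).
Proof. by []. Qed.

Lemma Im_inv t s : complex.Im (pt t s)^-1 = - s / (t ^+ 2 + s ^+ 2).
Proof. by rewrite mulNr. Qed.

Lemma kernel_edges a b c d x y : a < x < b -> c < y < d ->
  on_edges a b c d (fun w => w != pt x y).
Proof.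
by move=> /andP[ax xb] /andP[cy yd]; split => [t tt|s ss]; split; apply/negP => /eqP[]; lra.
Qed.

Lemma kernel_cont a b c d x y : a < x < b -> c < y < d ->
  on_edges a b c d (cont_at (fun w => (w - pt x y)^-1)).
Proof.
move=> xab ycd; apply: edges_impl (kernel_edges xab ycd) => w wz.
by apply: cderivable_cont; exact: cderivable_kernel.
Qed.

(** All four sides contribute positively to the imaginary part of the winding
    integral, which is [2 pi]; crude bounds for the kernel on them suffice. *)
Lemma winding_lower x0 y0 al x y : 0 < al ->
  `|x - x0| <= al / 2 -> `|y - y0| <= al / 2 ->
  1 / 2 <= nr (bint (fun w => (w - pt x y)^-1) (x0 - al) (x0 + al) (y0 - al) (y0 + al)).
Proof.
move=> al0; rewrite !ler_norml => /andP[x1 x2] /andP[y1 y2].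
set a := x0 - al; set b := x0 + al; set c := y0 - al; set d := y0 + al.
have xab : a < x < b by rewrite /a /b; apply/andP; split; lra.
have ycd : c < y < d by rewrite /c /d; apply/andP; split; lra.
have ab : a <= b by rewrite /a /b; lra.
have cd : c <= d by rewrite /c /d; lra.
have ce := kernel_cont xab ycd.
set k := fun w => _ in ce *.
have low u v : al / 2 <= v -> v <= 3 / 2 * al -> `|u| <= 3 / 2 * al ->
    1 / (9 * al) <= v / (u ^+ 2 + v ^+ 2).
  move=> v1 v2 u1; have u2 : u ^+ 2 <= (3 / 2 * al) ^+ 2.
    by rewrite -real_normK ?num_real// ler_pXn2r ?nnegrE// mulr_ge0// ltW.
  have v0 : 0 < u ^+ 2 + v ^+ 2 by rewrite ltr_wpDl ?sqr_ge0// exprn_gt0//; lra.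
  rewrite ler_pdivlMr// mulrAC ler_pdivrMr ?mulr_gt0// mul1r.
  have : v ^+ 2 <= (3 / 2 * al) ^+ 2 by rewrite ler_pXn2r ?nnegrE//; lra.
  move: u2; rewrite !expr2; nra.
have h1 : 4 / 9 <= complex.Im (cint (fun t => k (pt t c) - k (pt t d)) a b).
  have -> : 4 / 9 = (2 / (9 * al)) * (b - a) by rewrite /a /b; field; lra.
  rewrite -rint_cst//; apply: le_rint; [exact: rcont_cst|exact: ccontIm (edges_hor ce)|].
  move=> t /andP[t1 t2]; rewrite ImB /k !ptB !Im_inv -mulNr opprK.
  have -> : 2 / (9 * al) = 1 / (9 * al) + 1 / (9 * al) by lra.
  have tb : `|t - x| <= 3 / 2 * al.
    by rewrite ler_norml; apply/andP; split; rewrite /a /b in t1 t2; lra.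
  apply: lerD; last by apply: low; rewrite // /d; lra.
  by rewrite -(sqrrN (c - y)); apply: low; rewrite // /c; lra.
have h2 : 4 / 9 <= complex.Re (cint (fun s => k (pt b s) - k (pt a s)) c d).
  have -> : 4 / 9 = (2 / (9 * al)) * (d - c) by rewrite /c /d; field; lra.
  rewrite -rint_cst//; apply: le_rint; [exact: rcont_cst|exact: ccontRe (edges_ver ce)|].
  move=> t /andP[t1 t2]; rewrite ReB /k !ptB !Re_inv -mulNr.
  have -> : 2 / (9 * al) = 1 / (9 * al) + 1 / (9 * al) by lra.
  have tb : `|t - y| <= 3 / 2 * al.
    by rewrite ler_norml; apply/andP; split; rewrite /c /d in t1 t2; lra.
  rewrite ![_ + (t - y) ^+ 2]addrC.
  apply: lerD; first by apply: low; rewrite // /b; lra.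
  by rewrite -(sqrrN (a - x)); apply: low; rewrite // /a; lra.
apply: le_trans (Im_le_nr _); apply: le_trans (ler_norm _).
rewrite /bint; move: h1 h2; set p := cint _ a b; set q := cint _ c d.
by case: p => p1 p2; case: q => q1 q2 /=; lra.
Qed.

(** Both sides of the integral formula depend on the point through the kernel
    only, and the kernel is smooth away from the boundary of the square. *)
Lemma holo_lipschitz f (z0 : CC R) r : 0 < r ->
  (forall w, nr (w - z0) < r -> cderivable f w) ->
  exists dl L, [/\ 0 < dl, 0 <= L & forall z z', nr (z - z0) < dl -> nr (z' - z0) < dl ->
    nr (f z - f z') <= L * nr (z - z')].
Proof.
move=> r0 df; have /df/cderivable_cont cz : nr (z0 - z0) < r by rewrite subrr nr0.
have /cont_nrP/(_ 1 ltr01)/(iffLR (nbhs_nrP _ _))[d0 d00 near_z] := cz.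
pose M := nr (f z0) + 1.
have M0 : 0 < M by rewrite ltr_wpDl ?nr_ge0.
have fM w : nr (w - z0) < d0 -> nr (f w) <= M.
  move=> /near_z /=; have := nr_tri (f z0) (f w) 0; rewrite !subr0 /M; lra.
pose al := Num.min r d0 / 4.
have al0 : 0 < al by rewrite divr_gt0// lt_min r0.
have alr : al + al < r.
  have : Num.min r d0 <= r by rewrite ge_min lexx.
  by rewrite /al; lra.
have ald : al + al < d0.
  have : Num.min r d0 <= d0 by rewrite ge_min lexx orbT.
  by rewrite /al; lra.
have [x0 [y0 z0E]] : exists x0 y0, z0 = pt x0 y0 by exists (complex.Re z0), (complex.Im z0); exact: ptE.
set a := x0 - al; set b := x0 + al; set c := y0 - al; set d := y0 + al.
have ab : a <= b by rewrite /a /b; lra.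
have cd : c <= d by rewrite /c /d; lra.
have close t s : a <= t <= b -> c <= s <= d -> nr (pt t s - z0) <= al + al.
  rewrite /a /b /c /d z0E ptB => /andP[t1 t2] /andP[s1 s2].
  by apply: le_trans (nr_pt _ _) _; apply: lerD; rewrite ler_norml; apply/andP; split; lra.
have dfr : on_rect a b c d (cderivable f).
  by move=> t s tt ss; apply: df; exact: le_lt_trans (close t s tt ss) alr.
have fMr : on_rect a b c d (fun w => nr (f w) <= M).
  by move=> t s tt ss; apply: fM; exact: le_lt_trans (close t s tt ss) ald.
pose K z := bint (fun w => (w - z)^-1) a b c d.
pose S z := bint (fun w => f w * (w - z)^-1) a b c d.
have inner z : nr (z - z0) < al / 2 -> exists x y, [/\ z = pt x y, a < x < b, c < y < d,
   `|x - x0| <= al / 2 & `|y - y0| <= al / 2].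
  move=> zz; exists (complex.Re z), (complex.Im z).
  have hx : `|complex.Re z - x0| <= al / 2.
    by apply: le_trans (ltW zz); rewrite z0E; rewrite -[x0 in X in X <= _]/(complex.Re (pt x0 y0)) -ReB; exact: Re_le_nr.
  have hy : `|complex.Im z - y0| <= al / 2.
    by apply: le_trans (ltW zz); rewrite z0E; rewrite -[y0 in X in X <= _]/(complex.Im (pt x0 y0)) -ImB; exact: Im_le_nr.
  split=> //; first exact: ptE.
    by move: hx; rewrite /a /b ler_norml => /andP[? ?]; apply/andP; split; lra.
  by move: hy; rewrite /c /d ler_norml => /andP[? ?]; apply/andP; split; lra.
have far z : nr (z - z0) < al / 2 -> on_edges a b c d (fun w => nr (w - z)^-1 <= 2 / al).
  move=> /inner[x [y [-> _ _ hx hy]]].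
  suff : on_edges a b c d (fun w => al / 2 <= nr (w - pt x y)).
    apply: edges_impl => w hw; rewrite nrV -[2 / al]invrK invf_div lef_pV2// posrE.
      by apply: lt_le_trans hw; rewrite divr_gt0.
    by rewrite divr_gt0.
  move: hx hy; rewrite !ler_norml => /andP[x1 x2] /andP[y1 y2].
  split=> [t _|s _]; rewrite !ptB; split.
  - apply: le_trans (Im_le_nr _) => /=; rewrite /c ler_normr; apply/orP; right; lra.
  - apply: le_trans (Im_le_nr _) => /=; rewrite /d ler_normr; apply/orP; left; lra.
  - apply: le_trans (Re_le_nr _) => /=; rewrite /a ler_normr; apply/orP; right; lra.
  - apply: le_trans (Re_le_nr _) => /=; rewrite /b ler_normr; apply/orP; left; lra.
have edf := rect_edges ab cd dfr; have efM := rect_edges ab cd fMr.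
(* the kernel integral against any bounded continuous weight is Lipschitz *)
have kerlip g M' z z' : 0 <= M' -> on_edges a b c d (cont_at g) ->
    on_edges a b c d (fun w => nr (g w) <= M') ->
    nr (z - z0) < al / 2 -> nr (z' - z0) < al / 2 ->
    nr (bint (fun w => g w * (w - z)^-1) a b c d - bint (fun w => g w * (w - z')^-1) a b c d)
      <= 64 * M' / al * nr (z - z').
  move=> M'0 cg gM zz zz'; have fz := far z zz; have fz' := far z' zz'.
  have [x [y [zE xab ycd _ _]]] := inner z zz.
  have [x' [y' [zE' xab' ycd' _ _]]] := inner z' zz'.
  have kz := kernel_cont xab ycd; have kz' := kernel_cont xab' ycd'.
  have nz := kernel_edges xab ycd; have nz' := kernel_edges xab' ycd'.
  rewrite -zE in kz nz; rewrite -zE' in kz' nz'.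
  have cz1 : on_edges a b c d (cont_at (fun w => g w * (w - z)^-1)).
    by have := edges_and cg kz; apply: edges_impl => w [? ?]; exact: cont_atM.
  have cz2 : on_edges a b c d (cont_at (fun w => g w * (w - z')^-1)).
    by have := edges_and cg kz'; apply: edges_impl => w [? ?]; exact: cont_atM.
  rewrite -[- bint _ a b c d]mulN1r -bint_lin//.
  have -> : 64 * M' / al * nr (z - z') =
      4 * (M' * (2 / al * (2 / al) * nr (z - z'))) * ((b - a) + (d - c)).
    by rewrite /a /b /c /d; field; lra.
  apply: (bint_bound ab cd).
    have := edges_and cz1 cz2; apply: edges_impl => w [h1 h2].
    have h3 := @cont_atZ _ (-1) _ w h2.
    exact: (@cont_atD _ _ _ w h1 h3).
  have := edges_and (edges_and nz nz') (edges_and gM (edges_and fz fz')).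
  apply: edges_impl => w [[n1 n2] [h1 [h2 h3]]].
  have -> : g w * (w - z)^-1 + -1 * (g w * (w - z')^-1) =
     g w * ((w - z)^-1 * (w - z')^-1 * (z - z')).
    by field; rewrite !subr_eq0 n1 n2.
  rewrite !nrM; apply: ler_pM => //; rewrite ?nr_ge0 ?mulr_ge0 ?nr_ge0//.
  by apply: ler_wpM2r; rewrite ?nr_ge0//; apply: ler_pM; rewrite ?nr_ge0.
exists (al / 2), (2 * (64 * M / al + M * (64 * 1 / al))); split.
- by rewrite divr_gt0.
- have : 0 <= M / al by rewrite divr_ge0 ?ltW.
  lra.
move=> z z' zz zz'.
have Slip := kerlip f M z z' (ltW M0) (edges_impl (@cderivable_cont _ f) edf) efM zz zz'.
have Klip : nr (K z - K z') <= 64 * 1 / al * nr (z - z').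
  have cst1 w : cont_at (fun=> 1 : CC R) w.
    by apply/cont_nrP => e e0; apply: filterE => v /=; rewrite subrr nr0.
  have := kerlip (fun=> 1) 1 z z' ler01 (edges_all _ _ _ _ cst1).
  have n1 (w : CC R) : nr (1 : CC R) <= 1 by rewrite nr1.
  move=> /(_ (edges_all _ _ _ _ n1) zz zz').
  have E v : bint (fun w => 1 * (w - v)^-1) a b c d = K v.
    by apply: eq_bint; apply: edges_all => w; rewrite mul1r.
  by rewrite !E.
have [x [y [zE xab ycd hx hy]]] := inner z zz.
have [x' [y' [zE' xab' ycd' _ _]]] := inner z' zz'.
have Sz : S z = f z * K z by rewrite /S /K zE; exact: cauchy_formula.
have Sz' : S z' = f z' * K z' by rewrite /S /K zE'; exact: cauchy_formula.
have K1 : 1 / 2 <= nr (K z) by rewrite /K zE; exact: winding_lower.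
have E : (f z - f z') * K z = (S z - S z') + (- f z') * (K z - K z').
  by rewrite Sz Sz'; ring.
have fz' : nr (f z') <= M by apply: fM; apply: lt_trans zz' _; lra.
have : nr (f z - f z') * nr (K z) <=
    64 * M / al * nr (z - z') + M * (64 * 1 / al * nr (z - z')).
  rewrite -nrM E; apply: le_trans (nrD _ _) _; apply: lerD => //.
  by rewrite nrM nrN; apply: ler_pM; rewrite ?nr_ge0.
have := nr_ge0 (f z - f z'); move: K1.
set A := nr (f z - f z'); set B := nr (K z); set D := nr (z - z').
move=> B1 A0; have : A * (1 / 2) <= A * B by rewrite ler_wpM2l.
lra.
Qed.

End HolomorphicLipschitz.

(** * The hyperbolic tangent *)

Section Tanh.
Context {R : realType}.
Implicit Types (s t u x y r : R).

(** The hyperbolic tangent: [th t] is the Euclidean radius of the hyperbolic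
    circle of radius [t] about the centre of the disc. *)
Definition th t : R := (expR (2 * t) - 1) / (expR (2 * t) + 1).

Lemma th_den t : 0 < expR (2 * t) + 1.
Proof. by rewrite addr_gt0 ?expR_gt0. Qed.

Lemma th0 : th 0 = 0.
Proof. by rewrite /th mulr0 expR0 subrr mul0r. Qed.

Lemma thN t : th (- t) = - th t.
Proof.
rewrite /th mulrN expRN; have := expR_gt0 (2 * t); move: (expR _) => e e0.
field; lra.
Qed.

Lemma th_lt1 t : th t < 1.
Proof. by rewrite /th ltr_pdivrMr ?th_den// mul1r; lra. Qed.

Lemma th_gtN1 t : -1 < th t.
Proof. by rewrite ltrNl -thN th_lt1. Qed.

Lemma th_abs t : `|th t| < 1.
Proof. by rewrite ltr_norml th_lt1 th_gtN1. Qed.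

Lemma thD s t : th (s + t) = (th s + th t) / (1 + th s * th t).
Proof.
rewrite /th mulrDr expRD; have := expR_gt0 (2 * s); have := expR_gt0 (2 * t).
move: (expR _) (expR _) => p q p0 q0.
field; do ?[apply/andP; split]; try lra; try nra.
Qed.

Lemma th_mul_gt s t : 0 < 1 + th s * th t.
Proof. have := th_abs s; have := th_abs t; rewrite !ltr_norml; nra. Qed.

Lemma th_sub s t : th s - th t = th (s - t) * (1 - th s * th t).
Proof.
rewrite thD thN mulrN divfK//.
have := th_mul_gt s (- t); rewrite thN; lra.
Qed.

Lemma th_ge0 t : 0 <= t -> 0 <= th t.
Proof.
move=> t0; apply: divr_ge0; last exact: ltW (th_den _).
by rewrite subr_ge0 -expR0 ler_expR mulr_ge0.
Qed.

Lemma th_homo s t : s <= t -> th s <= th t.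
Proof.
move=> st; rewrite -subr_ge0 th_sub mulr_ge0 ?th_ge0 ?subr_ge0//.
have := th_mul_gt t (- s); rewrite thN; lra.
Qed.

Lemma th_gt0 t : 0 < t -> 0 < th t.
Proof.
by move=> t0; rewrite divr_gt0 ?th_den// subr_gt0 -expR0 ltr_expR mulr_gt0.
Qed.

Lemma th_lower u : 0 <= u -> u / (1 + u) <= th u.
Proof.
move=> u0; have h := expR_ge1Dx (2 * u).
rewrite /th ler_pdivrMr; last by lra.
rewrite mulrAC ler_pdivlMr ?th_den//; nra.
Qed.

Lemma th_upper u : 0 <= u -> u < 1 -> th u <= u / (1 - u).
Proof.
move=> u0 u1; have := expR_ge1Dx (- (2 * u)); rewrite expRN.
have e0 := expR_gt0 (2 * u).
rewrite -(ler_pM2l e0) mulfV ?gt_eqF// => h.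
rewrite /th ler_pdivlMr ?subr_gt0// mulrAC ler_pdivrMr ?th_den//; nra.
Qed.

Lemma th_le2 u : 0 <= u -> th u <= 2 * u.
Proof.
move=> u0; have [u1|u1] := leP (1 / 2) u.
  by apply: le_trans (ltW (th_lt1 u)) _; lra.
apply: le_trans (th_upper u0 _) _; first lra.
by rewrite ler_pdivrMr ?subr_gt0; [nra|lra].
Qed.

Lemma th_abs_le u : `|th u| <= 2 * `|u|.
Proof.
have [u0|u0] := leP 0 u.
  by rewrite !ger0_norm ?th_ge0// th_le2.
by rewrite -normrN -thN -(normrN u) !ger0_norm ?th_ge0 ?th_le2// oppr_ge0 ltW.
Qed.

Lemma th_lip s t : `|th s - th t| <= 4 * `|s - t|.
Proof.
rewrite th_sub normrM; have := th_abs_le (s - t).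
have : `|1 - th s * th t| <= 2.
  have := th_abs s; have := th_abs t; rewrite !ltr_norml ler_norml; nra.
have := normr_ge0 (1 - th s * th t); have := normr_ge0 (th (s - t)).
by move: `|_| `|_| `|_| => A B C; nra.
Qed.

Lemma th_near0 u : `|u| <= 1 / 2 -> `|th u - u| <= 2 * u ^+ 2.
Proof.
have pos v : 0 <= v -> v <= 1 / 2 -> `|th v - v| <= 2 * v ^+ 2.
  move=> v0 v1; have l := th_lower v0; have h : th v <= v / (1 - v) by apply: th_upper; lra.
  rewrite ler_norml; apply/andP; split.
    apply: le_trans (_ : v / (1 + v) - v <= _); last by lra.
    have -> : v / (1 + v) - v = - (v ^+ 2 / (1 + v)) by field; lra.
    rewrite lerN2 ler_pdivrMr; last lra.
    by rewrite expr2; nra.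
  apply: (@le_trans _ _ (v / (1 - v) - v)); first by lra.
  have -> : v / (1 - v) - v = v ^+ 2 / (1 - v) by field; lra.
  rewrite ler_pdivrMr; last lra.
  by rewrite expr2; nra.
have [u0|u0] := leP 0 u; first by rewrite ger0_norm//; exact: pos.
rewrite ltr0_norm// => u1; have := pos (- u).
by rewrite thN -opprD normrN sqrrN oppr_ge0; apply => //; exact: ltW.
Qed.

Definition ath r : R := ln ((1 + r) / (1 - r)) / 2.

Lemma thK t : ath (th t) = t.
Proof.
rewrite /ath; have -> : (1 + th t) / (1 - th t) = expR (2 * t).
  rewrite /th; have := expR_gt0 (2 * t); move: (expR _) => e e0; field.
  by do ?[apply/andP; split]; lra.
by rewrite expRK; lra.
Qed.

Lemma athK r : -1 < r -> r < 1 -> th (ath r) = r.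
Proof.
move=> r1 r2; rewrite /th /ath.
have -> : 2 * (ln ((1 + r) / (1 - r)) / 2) = ln ((1 + r) / (1 - r)) by lra.
rewrite lnK; last by rewrite posrE divr_gt0; lra.
by field; lra.
Qed.

Lemma ath_ge0 r : 0 <= r -> r < 1 -> 0 <= ath r.
Proof.
move=> r0 r1; rewrite divr_ge0// ln_ge0// ler_pdivlMr; lra.
Qed.

Lemma th_tail t : 1 - th t <= 2 * expR (- (2 * t)).
Proof.
rewrite expRN /th; have := expR_gt0 (2 * t); move: (expR _) => e e0.
have -> : 1 - (e - 1) / (e + 1) = 2 / (e + 1) by field; lra.
by rewrite ler_pM2l// lef_pV2 ?posrE; lra.
Qed.

(** To first order the length [t] with [th x = r * th t] is [x / r], and
    [1 / r - 1] is comparable to [1 - r] when [r] stays away from [0]. *)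
Lemma th_shrink tau : 0 < tau -> tau < 1 -> exists h M, [/\ 0 < h, 0 < M &
  forall r x, tau <= r -> r < 1 -> 0 <= x -> x <= h ->
    th x <= r * th (x + M * (1 - r) * x)].
Proof.
move=> tau0 tau1; pose M := 4 / tau; pose h := tau / (32 * (1 + M)).
have M0 : 0 < M by rewrite divr_gt0.
have Mt : M * tau = 4 by rewrite /M; field; lra.
have h0 : 0 < h by rewrite divr_gt0// mulr_gt0//; lra.
exists h, M; split => // r x tr r1 x0 xh.
have hM : h * (1 + M) * 32 = tau by rewrite /h; field; lra.
set e := M * (1 - r); set y := x + e * x.
have e0 : 0 <= e by rewrite mulr_ge0; lra.
have eM : e <= M by rewrite /e; nra.
have yM : y <= tau / 32.
  have : e * x <= M * h by apply: ler_pM.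
  rewrite /y; lra.
have xy : x <= y by rewrite /y lerDl mulr_ge0.
have ex : e * x <= tau / 32 by rewrite /y in yM; lra.
have ex0 : 0 <= e * x by rewrite mulr_ge0.
have T1 := th_lower ex0.
have Ey : th y - th x = th (e * x) * (1 - th y * th x).
  by rewrite th_sub; congr (th _ * _); rewrite /y; lra.
have y0 : 0 <= y by lra.
have Ty : th y <= y / (1 - y) by apply: th_upper; lra.
have Tx : th x <= 2 * x by exact: th_le2.
have Ty2 : th y <= 2 * y by exact: th_le2.
have Tx0 := th_ge0 x0; have Ty0 := th_ge0 y0.
have P1 : 1 - tau / 8 <= 1 - th y * th x.
  have : th y * th x <= (2 * y) * (2 * x) by apply: ler_pM.
  have : y * x <= (tau / 32) * 1 by apply: ler_pM; lra.
  lra.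
have T1' : e * x * (1 - tau / 32) <= th (e * x).
  apply: le_trans T1; rewrite ler_pdivlMr; last lra.
  by nra.
have A : e * x * (1 - tau / 4) <= th y - th x.
  rewrite Ey; apply: le_trans (_ : e * x * (1 - tau / 32) * (1 - tau / 8) <= _).
    rewrite -[leRHS]mulrA; apply: ler_wpM2l => //; nra.
  by apply: ler_pM => //; [rewrite mulr_ge0//; lra|lra].
have Ty3 : th y <= y * (1 + tau / 4).
  apply: le_trans Ty _; rewrite ler_pdivrMr; last lra.
  by nra.
have : (1 - r) * th y <= e * x * (1 - tau / 4).
  have : (1 - r) * th y <= (1 - r) * (y * (1 + tau / 4)) by apply: ler_wpM2l; lra.
  have -> : e * x = (1 - r) * (M * x) by rewrite /e; ring.
  have -> : y * (1 + tau / 4) = x * ((1 + e) * (1 + tau / 4)) by rewrite /y; ring.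
  move=> /le_trans; apply.
  rewrite -[leRHS]mulrA; apply: ler_wpM2l; first lra.
  have -> : M * x * (1 - tau / 4) = x * (M * (1 - tau / 4)) by ring.
  apply: ler_wpM2l => //.
  (* with [M tau = 4] this is [(M - 3) (1 + tau / 4) <= M - 1] *)
  have e4 : e <= M - 4 by rewrite /e; nra.
  apply: (@le_trans _ _ ((M - 3) * (1 + tau / 4))); last by lra.
  by apply: ler_wpM2r; lra.
lra.
Qed.

End Tanh.

(** * Chains of normalised holomorphic discs *)

Section Discs.
Context {R : realType} {d : nat}.
Implicit Types (D : set 'CC[R]_d) (x y z w : 'CC[R]_d) (a b c v k : CC R) (l s t r : R).

Lemma conjCE a : a^* = pt (complex.Re a) (- complex.Im a).
Proof. by case: a. Qed.

(** The automorphism of the unit disc that sends [0] to [a]. *)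
Definition moebius a v : CC R := (a + v) * (1 + a^* * v)^-1.

Lemma moebius_den a v : nr a < 1 -> nr v < 1 -> 1 + a^* * v != 0.
Proof.
move=> a1 v1; apply/negP => /eqP H.
have : nr (a^* * v) = 1.
  have -> : a^* * v = -1 by apply/eqP; rewrite -addr_eq0 addrC H.
  by rewrite nrN nr1.
rewrite nrM; have -> : nr a^* = nr a by rewrite /nr norm_conjC.
have := nr_ge0 a; have := nr_ge0 v; nra.
Qed.

Lemma moebius_lt1 a v : nr a < 1 -> nr v < 1 -> nr (moebius a v) < 1.
Proof.
move=> a1 v1; have d0 := moebius_den a1 v1.
rewrite /moebius nrM nrV ltr_pdivrMr ?nr_gt0// mul1r.
rewrite -(@ltr_pXn2r _ 2) ?nnegrE ?nr_ge0// -subr_gt0.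
have -> : nr (1 + a^* * v) ^+ 2 - nr (a + v) ^+ 2 = (1 - nr a ^+ 2) * (1 - nr v ^+ 2).
  by rewrite !nr_sq; case: (a) => a1' a2; case: (v) => v1' v2 /=; ring.
by rewrite mulr_gt0// subr_gt0 exprn_ilt1 ?nr_ge0.
Qed.

Lemma cderivable_moebius a v : nr a < 1 -> nr v < 1 -> cderivable (moebius a) v.
Proof.
move=> a1 v1; rewrite /moebius.
apply: (@cderivableM _ (fun v => a + v) (fun v => (1 + a^* * v)^-1)).
  have := cderivable_affine a 1 v; congr cderivable; apply/funext => u.
  by rewrite mul1r.
apply: cderivableV; first exact: moebius_den.
exact: cderivable_affine.
Qed.

Lemma moebius_toCC s t :
  moebius (toCC (th s)) (toCC (th t)) = toCC (th (s + t)).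
Proof.
rewrite /moebius thD toCCM toCCV !toCCD toCCM toCC1; congr (_ * (1 + _ * _)^-1).
by rewrite conjCE /toCC /= oppr0.
Qed.

Lemma nr_th t : nr (toCC (th t)) < 1.
Proof. by rewrite nr_toCC th_abs. Qed.

Lemma holo_discP D (f : CC R -> 'CC[R]_d) : holo_disc D f <->
  forall v, nr v < 1 -> (exists l : 'CC[R]_d, cdiff f v l) /\ D (f v).
Proof.
split=> H v; first by rewrite -nr_lt1 => /H[/cdiff_derivable].
by rewrite nr_lt1 => /H[/cdiff_derivable].
Qed.

Lemma holo_disc_comp D (f : CC R -> 'CC[R]_d) (phi : CC R -> CC R) :
  (forall v, nr v < 1 -> cderivable phi v /\ nr (phi v) < 1) ->
  holo_disc D f -> holo_disc D (f \o phi).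
Proof.
move=> H /holo_discP fD; apply/holo_discP => v v1.
have [[m pm] p1] := H v v1; have [[l fl] Df] := fD _ p1.
by split=> //; exists (m *: l); exact: cdiff_comp.
Qed.

Lemma holo_disc_moebius D f a : nr a < 1 -> holo_disc D f ->
  holo_disc D (f \o moebius a).
Proof.
by move=> a1; apply: holo_disc_comp => v v1; split; [exact: cderivable_moebius|exact: moebius_lt1].
Qed.

Lemma cderivable_scale k v : cderivable (fun u : CC R => k * u) v.
Proof.
have := cderivable_affine 0 k v; congr cderivable; apply/funext => u.
by rewrite add0r.
Qed.

Lemma holo_disc_scale D f k : nr k <= 1 -> holo_disc D f ->
  holo_disc D (f \o (fun v => k * v)).
Proof.
move=> k1; apply: holo_disc_comp => v v1; split; first exact: cderivable_scale.
by rewrite nrM; have := nr_ge0 k; have := nr_ge0 v; nra.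
Qed.

(** Taking [x] as the centre of the disc loses nothing, since the disc has a
    transitive group of automorphisms, and makes geodesic segments explicit. *)
Definition link D x y l : Prop :=
  0 <= l /\ exists f, [/\ holo_disc D f, f 0 = x & f (toCC (th l)) = y].

Inductive disc_chain D : 'CC[R]_d -> 'CC[R]_d -> R -> Prop :=
| chain_link x y l of link D x y l : disc_chain D x y l
| chain_cons x y z l l' of link D x y l & disc_chain D y z l' : disc_chain D x z (l + l').

Lemma chain_trans D x y z l l' : disc_chain D x y l -> disc_chain D y z l' -> disc_chain D x z (l + l').
Proof.
move=> xy; elim: xy z l' => [x' y' k xy z l' yz|x' y' w k k' xy yw IH z l' wz].
  exact: chain_cons xy yz.
by rewrite -addrA; apply: chain_cons xy _; exact: IH.
Qed.

Lemma chain_ge0 D x y l : disc_chain D x y l -> 0 <= l.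
Proof. by elim=> {x y l} [x y l []//|x y z l l' [l0 _] _]; exact: addr_ge0. Qed.

Lemma link_sym D x y l : link D x y l -> link D y x l.
Proof.
move=> [l0 [f [fD fx fy]]]; split=> //.
exists ((f \o moebius (toCC (th l))) \o (fun v => (-1) * v)); split.
- apply: holo_disc_scale; first by rewrite nrN nr1.
  by apply: holo_disc_moebius => //; exact: nr_th.
- by rewrite /= mulr0 /moebius mulr0 !addr0 invr1 mulr1.
- by rewrite /= mulN1r -toCCN -thN moebius_toCC subrr th0 toCC0.
Qed.

Lemma link_in D x y l : link D x y l -> D x /\ D y.
Proof.
move=> [l0 [f [/holo_discP fD <- <-]]]; split; apply: (proj2 (fD _ _)).
  by rewrite nr0.
exact: nr_th.
Qed.

Lemma chain_in D x y l : disc_chain D x y l -> D x /\ D y.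
Proof.
elim=> {x y l} [x y l xy|x y z l l' xy _ [_ Dz]]; first exact: link_in xy.
by have [] := link_in xy.
Qed.

Lemma chain_sym D x y l : disc_chain D x y l -> disc_chain D y x l.
Proof.
elim=> {x y l} [x y l xy|x y z l l' xy _ zy]; first exact/chain_link/link_sym.
by rewrite addrC; apply: chain_trans zy _; exact/chain_link/link_sym.
Qed.

Lemma link_refl D x : D x -> link D x x 0.
Proof.
by move=> Dx; split=> //; exists (fun=> x); split.
Qed.

Lemma chain_refl D x : D x -> disc_chain D x x 0.
Proof. by move=> /link_refl; exact: chain_link. Qed.

Lemma poincare_th l : 0 <= l -> poincare (0 : CC R) (toCC (th l)) = l.
Proof.
move=> l0; rewrite /poincare conjC0 mul0r subr0 divr1 sub0r.
rewrite -[complex.Re _]/(nr (- toCC (th l))) nrN nr_toCC ger0_norm ?th_ge0//.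
exact: thK.
Qed.

Lemma moebius_diff a b : nr a < 1 -> nr b < 1 ->
  moebius a ((b - a) / (1 - a^* * b)) = b.
Proof.
move=> a1 b1.
have e1 : 1 - a^* * b != 0.
  by have := @moebius_den a (- b); rewrite nrN mulrN; apply.
have e2 : 1 - a^* * a != 0.
  by have := @moebius_den a (- a); rewrite nrN mulrN; apply.
rewrite /moebius; field; rewrite e1 /=.
have -> : 1 - a^* * b + a^* * (b - a) = 1 - a^* * a by ring.
exact: e2.
Qed.

(** Move [a] to the centre by an automorphism of the disc and rotate [b] to the
    positive axis. *)
Lemma link_poincare D f a b : holo_disc D f -> nr a < 1 -> nr b < 1 ->
  link D (f a) (f b) (poincare a b).
Proof.
move=> fD a1 b1; set c := (b - a) / (1 - a^* * b).
have bE : moebius a c = b by exact: moebius_diff.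
have c1 : nr c < 1.
  have e1 : 1 - a^* * b != 0.
    by have := @moebius_den a (- b); rewrite nrN mulrN; apply.
  have := @moebius_lt1 (- a) b; rewrite nrN => /(_ a1 b1).
  by rewrite /moebius rmorphN mulNr addrC.
have pE : poincare a b = ath (nr c).
  rewrite /poincare /ath -[complex.Re _]/(nr ((a - b) / (1 - a^* * b))).
  by rewrite /c -nrN -mulNr opprB.
have c0 := nr_ge0 c.
rewrite pE; split; first exact: ath_ge0.
have [u [u1 uc]] : exists u : CC R, nr u = 1 /\ u * toCC (nr c) = c.
  have [->|cN0] := eqVneq c 0; first by exists 1; rewrite nr1 nr0 toCC0 mulr0.
  exists (c / toCC (nr c)); rewrite nrM nrV nr_toCC ger0_norm//.
  have nc0 : nr c != 0 by rewrite nr_eq0.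
  by rewrite divff// divfK// -[0]toCC0 (inj_eq toCC_inj).
exists ((f \o moebius a) \o (fun v => u * v)); split.
- apply: holo_disc_scale; first by rewrite u1.
  exact: holo_disc_moebius.
- by rewrite /= mulr0 /moebius mulr0 !addr0 invr1 mulr1.
- by rewrite /= athK//; [rewrite uc bE|lra].
Qed.

Lemma disc_chain_kob_chain D x y l : disc_chain D x y l -> kob_chain D x y l.
Proof.
elim=> {x y l} [x y l [l0 [f [fD fx fy]]]|x y z l l' [l0 [f [fD fx fy]]] _].
  exists 0%N, (fun n => if n is 0%N then x else y), (fun=> f), (fun=> 0), (fun=> toCC (th l)).
  split=> //; last by rewrite big_ord_recl big_ord0 addr0 poincare_th.
  case=> // _; split=> //; first by rewrite normr0 ltr01.
  by rewrite nr_lt1 nr_th.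
move=> [m [p [g [a [b [p0 pm H ->]]]]]].
exists m.+1, (fun n => if n is n'.+1 then p n' else x),
  (fun n => if n is n'.+1 then g n' else f),
  (fun n => if n is n'.+1 then a n' else 0),
  (fun n => if n is n'.+1 then b n' else toCC (th l)); split=> //.
  case=> [_|j jm]; last by have := H j jm.
  split=> //; first by rewrite normr0 ltr01.
    by rewrite nr_lt1 nr_th.
  by rewrite p0.
rewrite [RHS]big_ord_recl; congr (_ + _).
exact/esym/poincare_th.
Qed.

Lemma kob_chain_disc_chain D x y l : kob_chain D x y l -> disc_chain D x y l.
Proof.
move=> [m [p [f [a [b [<- <- + ->]]]]]].
elim: m p f a b => [|m IH] p f a b H.
  have [fD a1 b1 <- <-] := H 0%N isT.
  rewrite big_ord_recl big_ord0 addr0; apply: chain_link; apply: link_poincare => //.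
    by rewrite -nr_lt1.
  by rewrite -nr_lt1.
rewrite big_ord_recl; have [fD a1 b1 f0 f1] := H 0%N isT.
apply: (@chain_cons _ _ (p 1%N)).
  rewrite -f0 -f1; apply: link_poincare => //.
    by rewrite -nr_lt1.
  by rewrite -nr_lt1.
have := IH (p \o S) (f \o S) (a \o S) (b \o S).
by apply=> j jm; exact: (H j.+1 jm).
Qed.

Lemma kobayashi_le D x y l : disc_chain D x y l -> (kobayashi D x y <= l%:E)%E.
Proof. by move=> /disc_chain_kob_chain xy; apply: ereal_inf_lbound; exists l. Qed.

Lemma kobayashi_ge D x y (e : \bar R) : (forall l, disc_chain D x y l -> (e <= l%:E)%E) ->
  (e <= kobayashi D x y)%E.
Proof. by move=> H; apply: le_ereal_inf_tmp => _ [l /kob_chain_disc_chain xy <-]; exact: H. Qed.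

End Discs.

(** * Uniform choices on compact sets *)

Section CompactDirected.
Context {T : topologicalType}.

(** Finitely many of the given neighbourhoods cover [K], and their indices have
    a common upper bound. *)
Lemma compact_directed (I : Type) (le : I -> I -> Prop) (i0 : I) (K : set T)
    (P : I -> T -> Prop) :
  (forall i, le i i) -> (forall i j k, le i j -> le j k -> le i k) ->
  (forall i j, exists k, le i k /\ le j k) ->
  (forall i j x, le i j -> P i x -> P j x) ->
  compact K -> (forall x, K x -> exists i, nbhs x (P i)) ->
  exists i, forall x, K x -> P i x.
Proof.
move=> refl trans dir mono /compact_near_coveringP cK loc.
pose F : set_system I := [set A | exists i, forall j, le i j -> A j].
have FF : Filter F.
  split.
  - by exists i0.
  - move=> A B [i Ai] [j Bj]; have [k [ik jk]] := dir i j; exists k => l kl.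
    by split; [apply: Ai; exact: trans kl|apply: Bj; exact: trans kl].
  - by move=> A B AB [i Ai]; exists i => j /Ai /AB.
have [i Hi] : F (fun i => K `<=` P i).
  apply: (cK I F P FF) => x /loc[i Pi].
  exists (P i, [set j | le i j]) => /=; first by split=> //; exists i.
  by move=> [y j] /= [Py ij]; exact: mono ij Py.
by exists i => x Kx; exact: Hi (refl i) x Kx.
Qed.

Lemma compact_nat (K : set T) (P : nat -> T -> Prop) :
  (forall i j x, (i <= j)%N -> P i x -> P j x) ->
  compact K -> (forall x, K x -> exists i, nbhs x (P i)) ->
  exists i, forall x, K x -> P i x.
Proof.
apply: (@compact_directed nat (fun i j => (i <= j)%N) 0%N) => //.
- by move=> i j k; exact: leq_trans.
- by move=> i j; exists (maxn i j); rewrite leq_maxl leq_maxr.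
Qed.

End CompactDirected.

(** * Lipschitz bounds along holomorphic discs *)

Section LipschitzDiscs.
Context {R : realType} {d : nat}.
Implicit Types (D : set 'CC[R]_d) (x y z w : 'CC[R]_d) (a b l s t r : R).

Lemma nr_coord x i : nr (x ord0 i) <= nr x.
Proof.
rewrite -le_toCC -!nrE -[X in _ <= X]/(mx_norm x) mx_normE -[leLHS]nngE num_le.
exact: (le_bigmax _ (fun ij => `|x ij.1 ij.2|%:nng) (ord0, i)).
Qed.

Lemma nr_row_le x r : 0 <= r -> (forall i, nr (x ord0 i) <= r) -> nr x <= r.
Proof.
move=> r0 xr; have [->|x0] := eqVneq x 0; first by rewrite nr0.
have [|[i j] E] := @mx_norm_neq0 _ _ _ x.
  by apply: contra_neq x0; exact: mx_norm_eq0.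
have -> : nr x = nr (x i j) by rewrite /nr [`|x|]E.
by rewrite ord1.
Qed.

Lemma nat_bound r : exists n : nat, r <= n%:R.
Proof.
exists (Num.bound `|r|); apply: le_trans (ler_norm r) _.
by apply: ltW; exact: archi_boundP.
Qed.

Lemma nat_inv_bound r : 0 < r -> exists n : nat, n.+1%:R^-1 < r.
Proof.
move=> r0; have [n rn] := nat_bound r^-1; exists n.
rewrite invf_plt ?posrE//; apply: le_lt_trans rn _.
by rewrite ltr_nat.
Qed.

Lemma holo_coord (f : CC R -> 'CC[R]_d) (v : CC R) i (l : 'CC[R]_d) :
  cdiff f v l -> cderivable (fun u => f u ord0 i) v.
Proof.
move=> fl; exists (l ord0 i) => e e0; have [dl dl0 H] := fl e e0.
exists dl => // y /H; apply: le_trans.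
have -> : f y ord0 i - f v ord0 i - (y - v) *: l ord0 i =
  (f y - f v - (y - v) *: l) ord0 i by rewrite !mxE.
exact: nr_coord.
Qed.

(** One integer bounds both the inverse radius and the constant, so that the
    property is monotone in [n] and finitely many instances merge into one. *)
Definition lipschitz_near (U V : normedModType (CC R)) (n : nat) (g : U -> V) (t : U) :=
  forall s s' : U, nr (s - t) < n.+1%:R^-1 -> nr (s' - t) < n.+1%:R^-1 ->
    nr (g s - g s') <= n%:R * nr (s - s').

Lemma lipschitz_near_mono (U V : normedModType (CC R)) (m n : nat) (g : U -> V) (t : U) :
  (m <= n)%N -> lipschitz_near m g t -> lipschitz_near n g t.
Proof.
move=> mn H s s' st st'; apply: le_trans (H s s' _ _) _.
- apply: lt_le_trans st _; rewrite lef_pV2 ?posrE// ler_nat//.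
- apply: lt_le_trans st' _; rewrite lef_pV2 ?posrE// ler_nat//.
- by rewrite ler_wpM2r ?nr_ge0// ler_nat.
Qed.

Lemma holo_lipschitz_near (f : CC R -> CC R) (z0 : CC R) r : 0 < r ->
  (forall w : CC R, nr (w - z0) < r -> cderivable f w) -> exists n, lipschitz_near n f z0.
Proof.
move=> r0 df; have [dl [L [dl0 L0 H]]] := holo_lipschitz r0 df.
have [n1 hn1] := nat_inv_bound dl0; have [n2 hn2] := nat_bound L.
exists (maxn n1 n2) => s s' st st'.
have le : (maxn n1 n2).+1%:R^-1 <= n1.+1%:R^-1 :> R.
  by rewrite lef_pV2 ?posrE// ler_nat ltnS leq_maxl.
apply: le_trans (H s s' _ _) _.
- by apply: lt_trans hn1; exact: lt_le_trans le.
- by apply: lt_trans hn1; exact: lt_le_trans le.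
- rewrite ler_wpM2r ?nr_ge0//; apply: le_trans hn2 _.
  by rewrite ler_nat leq_maxr.
Qed.

Lemma disc_lipschitz_near D (f : CC R -> 'CC[R]_d) (z0 : CC R) : holo_disc D f ->
  nr z0 < 1 -> exists n, lipschitz_near n f z0.
Proof.
move=> /holo_discP fD z1; have r0 : 0 < 1 - nr z0 by rewrite subr_gt0.
have loc i : exists n, lipschitz_near n (fun u => f u ord0 i) z0.
  apply: (holo_lipschitz_near r0) => w wz; have [|[l fl] _] := fD w.
    by have := nr_tri z0 w 0; rewrite !subr0; lra.
  exact: holo_coord fl.
have [n Hn] := choice loc; exists (\max_i n i) => s s' st st'.
apply: nr_row_le => [|i]; first by rewrite mulr_ge0 ?nr_ge0.
have H := @lipschitz_near_mono _ _ _ _ _ _ (leq_bigmax i : (n i <= \max_i n i)%N) (Hn i).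
by have := H s s' st st'; rewrite !mxE.
Qed.

(** By compactness one constant serves at every point of the interval, for
    parameters at a definite distance; longer steps are cut into short ones. *)
Lemma lipschitz_segment (g : R -> 'CC[R]_d) a b :
  (forall t, a <= t <= b -> exists (n : nat), forall s s',
     `|s - t| < n.+1%:R^-1 -> `|s' - t| < n.+1%:R^-1 ->
     a <= s <= b -> a <= s' <= b -> nr (g s - g s') <= n%:R * `|s - s'|) ->
  exists L, 0 <= L /\ forall s s', a <= s <= b -> a <= s' <= b ->
     nr (g s - g s') <= L * `|s - s'|.
Proof.
move=> loc.
pose P (n : nat) t := forall s s',
     `|s - t| < n.+1%:R^-1 -> `|s' - t| < n.+1%:R^-1 ->
     a <= s <= b -> a <= s' <= b -> nr (g s - g s') <= n%:R * `|s - s'|.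
have mono (m n : nat) t : (m <= n)%N -> P m t -> P n t.
  move=> mn H s s' st st' sab sab'; apply: le_trans (H s s' _ _ sab sab') _.
  - apply: lt_le_trans st _; rewrite lef_pV2 ?posrE// ler_nat//.
  - apply: lt_le_trans st' _; rewrite lef_pV2 ?posrE// ler_nat//.
  - by rewrite ler_wpM2r// ler_nat.
have [n Hn] : exists n, forall t, `[a, b]%classic t -> P n t.
  apply: (compact_nat mono) => [|t]; first exact: segment_compact.
  rewrite /= in_itv /= => /loc[n Hn]; exists (n.*2.+1).
  apply/nbhs_ballP; exists (n.+1%:R^-1 / 2); first by rewrite /= divr_gt0.
  move=> t' tt'0 s s' st st' sab sab'.
  have tt' : `|t' - t| < n.+1%:R^-1 / 2 by rewrite distrC; exact: tt'0.
  have E : (n.*2.+1).+1%:R^-1 = n.+1%:R^-1 / 2 :> R.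
    by rewrite -doubleS -muln2 natrM invfM.
  rewrite E in st st'.
  apply: le_trans (Hn s s' _ _ sab sab') _.
  - by rewrite [ltRHS]splitr; apply: le_lt_trans (ler_distD t' _ _) (ltrD st tt').
  - by rewrite [ltRHS]splitr; apply: le_lt_trans (ler_distD t' _ _) (ltrD st' tt').
  - rewrite ler_wpM2r// ler_nat -addnn; exact: leq_trans (leq_addl n n) (leqnSn _).
pose h : R := n.+1%:R^-1 / 2.
have h0 : 0 < h by rewrite divr_gt0.
have hn : h < n.+1%:R^-1 by rewrite ltr_pdivrMr// ltr_pMr ?invr_gt0// ltr1n.
have nE (u v : R) : u <= v -> (`|v - u| = v - u) * (`|u - v| = v - u).
  by move=> uv; rewrite [`|u - v|]distrC ger0_norm// subr_ge0.
have chain N : forall s t, a <= s <= b -> a <= t <= b -> s <= t -> t - s <= N%:R * h ->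
    nr (g s - g t) <= n%:R * (t - s).
  elim: N => [|N IH] s t sab tab st.
    rewrite mul0r => ts; have -> : s = t by lra.
    by rewrite !subrr nr0 mulr0.
  have [small _|big] := leP (t - s) h.
    have := Hn s; rewrite /= in_itv /= => /(_ sab s t).
    rewrite subrr normr0 invr_gt0 ltr0n !(nE s t st) => /(_ isT).
    by apply => //; apply: le_lt_trans small hn.
  move=> ts; have sab' : a <= s + h <= b.
    by move: sab tab => /andP[? ?] /andP[? ?]; apply/andP; split; lra.
  have H1 : nr (g (s + h) - g t) <= n%:R * (t - (s + h)).
    apply: IH => //; first lra.
    by move: ts; rewrite -natr1; lra.
  have H2 : nr (g s - g (s + h)) <= n%:R * h.
    have := Hn s; rewrite /= in_itv /= => /(_ sab s (s + h)).
    have sh : s <= s + h by rewrite lerDl ltW.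
    rewrite subrr normr0 invr_gt0 ltr0n !(nE s (s + h) sh) [s + h]addrC addrK => /(_ isT).
    by apply => //; rewrite addrC.
  apply: le_trans (nr_tri (g (s + h)) _ _) _; lra.
exists n%:R; split=> // s s' sab sab'.
have [N HN] := nat_bound (`|s - s'| / h).
have HN' : `|s - s'| <= N%:R * h by rewrite -ler_pdivrMr.
have [ss'|/ltW s's] := leP s s'.
  have E : `|s - s'| = s' - s by rewrite distrC ger0_norm// subr_ge0.
  by rewrite E; apply: (chain N) => //; rewrite -E.
have E : `|s - s'| = s - s' by rewrite ger0_norm// subr_ge0.
by rewrite E nr_sym; apply: (chain N) => //; rewrite -E.
Qed.

Lemma disc_curve_lipschitz D (f : CC R -> 'CC[R]_d) a b : holo_disc D f ->
  exists L, 0 <= L /\ forall s s', a <= s <= b -> a <= s' <= b ->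
    nr (f (toCC (th (s - a))) - f (toCC (th (s' - a)))) <= L * `|s - s'|.
Proof.
move=> fD; apply: lipschitz_segment => t tab.
have [n Hn] := disc_lipschitz_near fD (nr_th (t - a)).
exists (4 * n.+1)%N => s s' st st' _ _.
have T u u' : nr (toCC (th (u - a)) - toCC (th (u' - a))) <= 4 * `|u - u'|.
  rewrite -toCCB nr_toCC; have := th_lip (u - a) (u' - a).
  by rewrite opprB addrA subrK.
have n0 : 0 < n.+1%:R^-1 :> R by [].
have E : (4 * n.+1).+1%:R^-1 <= n.+1%:R^-1 / 4 :> R.
  rewrite -invfM lef_pV2 ?posrE ?mulr_gt0// -natrM ler_nat.
  by rewrite mulnC.
apply: le_trans (Hn _ _ _ _) _.
- apply: le_lt_trans (T _ _) _.
  by rewrite mulrC -ltr_pdivlMr//; exact: lt_le_trans st E.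
- apply: le_lt_trans (T _ _) _.
  by rewrite mulrC -ltr_pdivlMr//; exact: lt_le_trans st' E.
- apply: le_trans (_ : n%:R * (4 * `|s - s'|) <= _); first by rewrite ler_wpM2l.
  rewrite mulrA ler_wpM2r// -natrM ler_nat mulnC leq_mul2l leqnSn orbT//.
Qed.

End LipschitzDiscs.

(** * Curves made of geodesic segments of discs *)

Section DiscCurves.
Context {R : realType} {d : nat}.
Implicit Types (D : set 'CC[R]_d) (x y z w : 'CC[R]_d) (g h : R -> 'CC[R]_d).
Implicit Types (a b c m l s t r e : R).

(** Concatenations of images of unit-speed hyperbolic geodesic segments under
    holomorphic discs. A chain of discs of total length [l] yields such a curve
    on [[0, l]], so almost-geodesics come from the definition of the Kobayashi
    distance and not from its integral form. *)
Inductive dcurve D g : R -> R -> Prop :=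
| dc_link a b f of a <= b & holo_disc D f &
    (forall t, a <= t <= b -> g t = f (toCC (th (t - a)))) : dcurve D g a b
| dc_cat a m b of dcurve D g a m & dcurve D g m b : dcurve D g a b.

Lemma dc_le D g a b : dcurve D g a b -> a <= b.
Proof. by elim=> // {}a m {}b _ am _; exact: le_trans. Qed.

Lemma dc_ext D g h a b : (forall t, a <= t <= b -> g t = h t) ->
  dcurve D g a b -> dcurve D h a b.
Proof.
move=> gh gD; elim: gD gh => {a b} [a b f ab fD gf gh|a m b am IH1 mb IH2 gh].
  by apply: (dc_link ab fD) => t tab; rewrite -gh// gf.
have [a1 m1] := (dc_le am, dc_le mb).
by apply: (@dc_cat _ _ a m b); [apply: IH1|apply: IH2] => t /andP[t1 t2]; apply: gh;
  apply/andP; split; lra.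
Qed.

Lemma dc_shift D g a b c : dcurve D g a b ->
  dcurve D (fun t => g (t + c)) (a - c) (b - c).
Proof.
elim=> {a b} [a b f ab fD gf|a m b am IH1 mb IH2]; last exact: dc_cat IH1 IH2.
apply: (@dc_link _ _ _ _ f); [by lra|by []|] => t /andP[t1 t2].
rewrite gf; last by apply/andP; split; lra.
by congr (f (toCC (th _))); lra.
Qed.

Lemma dc_rev D g a b : dcurve D g a b -> dcurve D (fun t => g (- t)) (- b) (- a).
Proof.
elim=> {a b} [a b f ab fD gf|a m b am IH1 mb IH2]; last exact: dc_cat IH2 IH1.
apply: (@dc_link _ _ _ _ ((f \o moebius (toCC (th (b - a)))) \o (fun v => (-1) * v))).
- by lra.
- apply: holo_disc_scale; first by rewrite nrN nr1.
  by apply: holo_disc_moebius => //; exact: nr_th.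
- move=> t /andP[t1 t2]; rewrite gf; last by apply/andP; split; lra.
  rewrite /= mulN1r -toCCN -thN moebius_toCC.
  by congr (f (toCC (th _))); lra.
Qed.

Lemma dc_sub D g a b s t : dcurve D g a b -> a <= s -> s <= t -> t <= b ->
  dcurve D g s t.
Proof.
move=> gD; elim: gD s t => {a b} [a b f ab fD gf|a m b am IH1 mb IH2] s t as_ st tb.
  apply: (@dc_link _ _ _ _ (f \o moebius (toCC (th (s - a))))) => //.
    by apply: holo_disc_moebius => //; exact: nr_th.
  move=> u /andP[u1 u2]; rewrite gf; last by apply/andP; split; lra.
  by rewrite /= moebius_toCC; congr (f (toCC (th _))); lra.
have [tm|mt] := leP t m; first exact: IH1.
have [ms|sm] := leP m s; first exact: IH2.
by apply: (@dc_cat _ _ s m t); [apply: IH1|apply: IH2] => //; exact: ltW.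
Qed.

Lemma dc_chain D g a b : dcurve D g a b -> disc_chain D (g a) (g b) (b - a).
Proof.
elim=> {a b} [a b f ab fD gf|a m b am IH1 mb IH2].
  apply: chain_link; split; first by lra.
  exists f; rewrite !gf ?lexx ?ab//; split=> //.
  by rewrite subrr th0 toCC0.
by have := chain_trans IH1 IH2; congr disc_chain; lra.
Qed.

Lemma dc_chain_sub D g a b s t : dcurve D g a b -> a <= s -> s <= t -> t <= b ->
  disc_chain D (g s) (g t) (t - s).
Proof. by move=> gD as_ st tb; apply: dc_chain; exact: dc_sub gD as_ st tb. Qed.

Lemma dc_in D g a b t : dcurve D g a b -> a <= t <= b -> D (g t).
Proof. by move=> gD /andP[at_ tb]; have [] := chain_in (dc_chain_sub gD at_ (lexx t) tb). Qed.

Lemma dc_exists D x y l : disc_chain D x y l -> exists g, [/\ dcurve D g 0 l, g 0 = x & g l = y].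
Proof.
elim=> {x y l} [x y l [l0 [f [fD fx fy]]]|x y z l l' [l0 [f [fD fx fy]]] yz [g [gD g0 gl]]].
  exists (fun t => f (toCC (th t))); split=> //; last by rewrite th0 toCC0.
  by apply: (@dc_link _ _ _ _ f) => // t _; rewrite subr0.
have l'0 := chain_ge0 yz.
exists (fun t => if t <= l then f (toCC (th t)) else g (t - l)); split.
- apply: (@dc_cat _ _ 0 l).
    by apply: (@dc_link _ _ _ _ f) => // t /andP[_ ->]; rewrite subr0.
  have := @dc_shift _ _ _ _ (- l) gD; rewrite sub0r opprK [l' + l]addrC.
  apply: dc_ext => t /andP[lt tl]; case: ifPn => // tl'.
  have tE : t = l by apply/eqP; rewrite eq_le tl'.
  by rewrite tE subrr g0 fy.
- by rewrite l0 th0 toCC0.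
- case: ifPn => [h|_]; last by rewrite [l + l']addrC addrK.
  have E : l' = 0 by lra.
  by rewrite E addr0 fy -gl E g0.
Qed.

Lemma dc_lip D g a b : dcurve D g a b -> exists L, 0 <= L /\
  forall s t, a <= s <= b -> a <= t <= b -> nr (g s - g t) <= L * `|s - t|.
Proof.
elim=> {a b} [a b f ab fD gf|a m b am [L1 [L10 H1]] mb [L2 [L20 H2]]].
  have [L [L0 H]] := disc_curve_lipschitz a b fD.
  by exists L; split=> // s t sab tab; rewrite !gf//; exact: H.
have [a1 m1] := (dc_le am, dc_le mb).
exists (L1 + L2); split=> [|s t]; first exact: addr_ge0.
wlog st : s t / s <= t => [W sab tab|].
  have [|/ltW] := leP s t; first by move=> st; exact: W.
  by move=> ts; rewrite nr_sym distrC; exact: W.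
move=> /andP[s1 s2] /andP[t1 t2].
have [tm|/ltW mt] := leP t m.
  apply: le_trans (H1 s t _ _) _; rewrite ?s1 ?t1 ?tm ?(le_trans st tm)//.
  by rewrite ler_wpM2r// lerDl.
have [ms|/ltW sm] := leP m s.
  apply: le_trans (H2 s t _ _) _; rewrite ?s2 ?t2 ?ms ?mt//.
  by rewrite ler_wpM2r// lerDr.
apply: le_trans (nr_tri (g m) _ _) _.
have e1 : `|s - m| <= `|s - t| by rewrite !ler0_norm ?subr_le0// lerN2 lerD2l lerN2.
have e2 : `|m - t| <= `|s - t| by rewrite !ler0_norm ?subr_le0// lerN2 lerD2r.
rewrite mulrDl; apply: lerD.
  apply: le_trans (H1 s m _ _) _; rewrite ?s1 ?sm ?a1 ?lexx//.
  by rewrite ler_wpM2l.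
apply: le_trans (H2 m t _ _) _; rewrite ?m1 ?mt ?t2 ?lexx//.
by rewrite ler_wpM2l.
Qed.

(** Complex differentiability on its own would not give absolute continuity; the
    Lipschitz bound behind [dc_lip] comes from Cauchy's formula. *)
Lemma dc_abs_continuous D g a b : dcurve D g a b -> abs_continuous `[a, b] g.
Proof.
move=> /dc_lip[L [L0 H]] e e0.
have L1 : 0 < L + 1 by rewrite ltr_wpDl.
exists (e / (L + 1)); first by rewrite divr_gt0.
move=> n p q pq _ small.
have E : \sum_(k < n) `|g (q k) - g (p k)| = toCC (\sum_(k < n) nr (g (q k) - g (p k))).
  rewrite /toCC rmorph_sum; apply: eq_bigr => k _; exact: nrE.
rewrite E lt_toCC; apply: le_lt_trans (_ : \sum_(k < n) (L + 1) * (q k - p k) < e).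
  apply: ler_sum => k _; have [pk sub] := pq k (ltn_ord k).
  have pin : a <= p k <= b by have := sub (p k); rewrite /= !in_itv /= lexx pk; apply.
  have qin : a <= q k <= b by have := sub (q k); rewrite /= !in_itv /= lexx pk; apply.
  apply: le_trans (H _ _ qin pin) _; rewrite ger0_norm ?subr_ge0//.
  by rewrite ler_wpM2r ?subr_ge0// lerDl.
by rewrite -mulr_sumr mulrC -ltr_pdivlMr.
Qed.

Lemma disc_curve_deriv D f (g : R -> 'CC[R]_d) t : holo_disc D f ->
  (\forall h \near (0 : R), g (t + h) = f (toCC (th h))) ->
  exists2 v, curve_deriv g t v & (kobayashi_royden D (g t) v <= 1)%E.
Proof.
move=> fD gf; have /holo_discP/(_ 0) := fD; rewrite nr0 ltr01 => /(_ isT)[[v fv] _].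
have g0 : g t = f 0.
  by have := nbhs_singleton gf; rewrite addr0 th0 toCC0.
exists v; last first.
  apply: ereal_inf_lbound; exists 1 => //; split=> //; exists f; split=> //.
  by rewrite toCC1 scale1r; exact: cdiff_derive1 fv.
rewrite /curve_deriv; apply/cvg_nrP => e e0.
have e10 : 0 < e / 4 by rewrite divr_gt0.
have [dl dl0 H] := fv (e / 4) e10.
have V0 : 0 < 4 * (nr v + 1) by rewrite mulr_gt0// ltr_wpDl ?nr_ge0.
pose r := Num.min (1 / 2) (Num.min (dl / 2) (e / (4 * (nr v + 1)))).
have r0 : 0 < r by rewrite !lt_min !divr_gt0.
near=> h.
have h0 : h != 0 by near: h; exact: nbhs_dnbhs_neq.
have gh : g (t + h) = f (toCC (th h)) by near: h; exact: nbhs_dnbhs.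
have : `|h| < r.
  near: h; apply: nbhs_dnbhs; apply/nbhs_ballP; exists r => // u.
  by rewrite /ball /= sub0r normrN.
rewrite !lt_min => /and3P[h1 h2 h3].
have th2 := th_abs_le h; have thn := th_near0 (ltW h1).
rewrite gh g0.
set y := toCC (th h).
have yn : nr y = `|th h| by rewrite nr_toCC.
have Hy : nr (f y - f 0 - y *: v) <= e / 4 * nr y.
  have := H y; rewrite subr0; apply; rewrite yn; lra.
have hc : toCC h != 0 by rewrite -[0]toCC0 (inj_eq toCC_inj).
have -> : toCC h^-1 *: (f y - f 0) - v =
  toCC h^-1 *: (f y - f 0 - y *: v) + (toCC (h^-1 * (th h - h))) *: v.
  rewrite [in RHS]scalerBr scalerA -/y mulrBr mulVf// toCCB toCC1 toCCM.
  by rewrite scalerBl scale1r addrA subrK.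
apply: le_lt_trans (nrD _ _) _; rewrite !nrZ !nr_toCC normrM normfV.
have hp : 0 < `|h| by rewrite normr_gt0.
have A1 : `|h|^-1 * nr (f y - f 0 - y *: v) <= e / 2.
  rewrite mulrC ler_pdivrMr//; apply: le_trans Hy _; rewrite yn.
  have : e / 4 * `|th h| <= e / 4 * (2 * `|h|) by rewrite ler_pM2l.
  lra.
have A2 : `|h|^-1 * `|th h - h| <= 2 * `|h|.
  by rewrite mulrC ler_pdivrMr// -mulrA -expr2 real_normK ?num_real.
have A3 : `|h|^-1 * `|th h - h| * nr v <= 2 * `|h| * nr v by rewrite ler_wpM2r ?nr_ge0.
have A4 : 2 * `|h| * nr v < e / 2.
  have : `|h| * (4 * (nr v + 1)) < e by rewrite -ltr_pdivlMr.
  lra.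
lra.
Unshelve. all: by end_near. Qed.

(** Away from the finitely many junction points the curve is locally
    [h |-> f (th h)] for a disc [f] centred at the current point, and this disc
    bounds the Kobayashi--Royden metric by [1]. *)
Lemma dc_deriv D g a b : dcurve D g a b -> exists S : seq R, forall t, a <= t <= b ->
  t \notin S -> exists2 v, curve_deriv g t v & (kobayashi_royden D (g t) v <= 1)%E.
Proof.
elim=> {a b} [a b f ab fD gf|a m b am [S1 H1] mb [S2 H2]]; last first.
  exists (S1 ++ S2) => t /andP[t1 t2]; rewrite mem_cat => /norP[n1 n2].
  have [tm|/ltW mt] := leP t m; first by apply: H1 => //; rewrite t1.
  by apply: H2 => //; rewrite mt.
exists [:: a; b] => t /andP[t1 t2]; rewrite !inE => /norP[ta tb].
apply: (@disc_curve_deriv D (f \o moebius (toCC (th (t - a))))).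
  by apply: holo_disc_moebius => //; exact: nr_th.
have t1' : a < t by rewrite lt_neqAle eq_sym ta.
have t2' : t < b by rewrite lt_neqAle tb.
apply/nbhs_ballP; exists (Num.min (t - a) (b - t)).
  by rewrite /= lt_min !subr_gt0 t1'.
move=> h; rewrite /ball /= sub0r normrN lt_min => /andP[h1 h2].
rewrite gf; last first.
  by move: h1 h2; rewrite !ltr_norml => /andP[? ?] /andP[? ?]; apply/andP; split; lra.
by rewrite moebius_toCC; congr (f (toCC (th _))); lra.
Qed.

Lemma finite_ae (S : seq R) (P : R -> Prop) : (forall t, t \notin S -> P t) ->
  {ae lebesgue_measure, forall t, P t}.
Proof.
move=> H; exists [set` S]; split.
- by apply: countable_measurable => //; apply: finite_set_countable; exact: finite_seq.
- by apply: countable_lebesgue_measure0; apply: finite_set_countable; exact: finite_seq.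
- by move=> t /= nP; apply: contrapT => tS; apply: nP; apply: H; apply/negP.
Qed.

End DiscCurves.

(** * Finiteness and separation properties of the Kobayashi distance *)

Section Topology.
Context {R : realType} {d : nat}.
Implicit Types (D K A B U V : set 'CC[R]_d) (x y z w : 'CC[R]_d) (g h : R -> 'CC[R]_d).
Implicit Types (a b l s t r e : R).

Lemma nbhs_nr_ball (T : normedModType (CC R)) (x : T) e : 0 < e ->
  nbhs x [set y | nr (y - x) < e].
Proof. by move=> e0; apply/nbhs_nrP; exists e. Qed.

Lemma closed_nr_ball (T : normedModType (CC R)) (x : T) r : closed [set y | nr (y - x) <= r].
Proof.
move=> y cy /=; apply/ler_addgt0Pr => e e0.
have [z [/= zx zy]] := cy _ (nbhs_nr_ball y e0).
by apply: le_trans (nr_tri z _ _) _; rewrite addrC (nr_sym y); lra.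
Qed.

Lemma compact_CC_ball r : compact [set v : CC R | nr v <= r].
Proof.
pose I : set R := [set` `[- r, r]].
have cI : compact (I `*` I) by apply: compact_setX; exact: segment_compact.
have pc : continuous (fun p : R * R => pt p.1 p.2).
  move=> [p q]; apply/cont_nrP => e e0; have e2 : 0 < e / 2 by rewrite divr_gt0.
  exists ([set p' | `|p' - p| < e / 2], [set q' | `|q' - q| < e / 2]).
    split; apply/nbhs_ballP; exists (e / 2) => // u; by rewrite /ball /= distrC.
  move=> [p' q'] [/= hp hq]; rewrite ptB; apply: le_lt_trans (nr_pt _ _) _; lra.
have cim := continuous_compact (continuous_subspaceT pc) cI.
apply: subclosed_compact cim _.
  have := @closed_nr_ball (CC R) 0 r; congr closed; apply/seteqP.
  by split => v /=; rewrite subr0.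
move=> v /= vr; exists (complex.Re v, complex.Im v); last by case: (v).
have := le_trans (Re_le_nr v) vr; have := le_trans (Im_le_nr v) vr.
by split; rewrite /I /= in_itv /= -ler_norml.
Qed.

Lemma compact_nr_ball r : compact [set x : 'CC[R]_d | nr x <= r].
Proof.
have [r0|r0] := leP 0 r; last first.
  have -> : [set x : 'CC[R]_d | nr x <= r] = set0.
    by apply/seteqP; split=> // x /=; have := nr_ge0 x; lra.
  exact: compact0.
have := @rV_compact (CC R) d (fun=> [set v : CC R | nr v <= r]) (fun=> @compact_CC_ball r).
congr compact; apply/seteqP; split=> x /=; first exact: nr_row_le.
by move=> xr i; apply: le_trans (nr_coord x i) xr.
Qed.

Lemma compact_nr_bounded K : compact K -> exists N : nat, forall x, K x -> nr x <= N%:R.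
Proof.
move=> cK; apply: (compact_nat (P := fun (n : nat) x => nr x <= n%:R)) => //.
  by move=> i j x ij /le_trans; apply; rewrite ler_nat.
move=> x _; have [n hn] := nat_bound (nr x + 1); exists n.
apply: filterS (nbhs_nr_ball x ltr01) => y /= yx.
by have := nr_tri x y 0; rewrite !subr0; lra.
Qed.

Lemma closure_nrP A x : closure A x <-> forall e, 0 < e -> exists2 y, A y & nr (y - x) < e.
Proof.
split=> [cA e e0|H B /nbhs_nrP[e e0 eB]].
  by have [y [Ay yx]] := cA _ (nbhs_nr_ball x e0); exists y.
by have [y Ay yx] := H e e0; exists y; split=> //; exact: eB.
Qed.

(** The neighbourhood of [K] of half a uniform radius on which balls stay inside
    [U]. *)
Lemma relcompact_between K U : compact K -> open U -> K `<=` U ->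
  exists V, [/\ open V, K `<=` V & relcompact V U].
Proof.
move=> cK oU KU.
have [n Hn] : exists n : nat, forall x, K x -> forall y, nr (y - x) < n.+1%:R^-1 -> U y.
  apply: (compact_nat (P := fun (n : nat) x => forall y, nr (y - x) < n.+1%:R^-1 -> U y)) => //.
    move=> i j x ij H y yx; apply: H; apply: lt_le_trans yx _.
    by rewrite lef_pV2 ?posrE// ler_nat ltnS.
  move=> x Kx; have /nbhs_nrP[e e0 eU] : nbhs x U by apply: open_nbhs_nbhs; split=> //; exact: KU.
  have e2 : 0 < e / 2 by rewrite divr_gt0.
  have [n hn] := nat_inv_bound e2; exists n.
  apply: filterS (nbhs_nr_ball x e2) => z /= zx y yz; apply: eU.
  by apply: le_lt_trans (nr_tri z _ _) _; rewrite [ltRHS]splitr ltrD// (lt_trans yz).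
pose r : R := n.+1%:R^-1.
have r0 : 0 < r by rewrite /r invr_gt0.
pose V : set 'CC[R]_d := [set y | exists2 x, K x & nr (y - x) < r / 2].
exists V; split.
- rewrite openE => y [x Kx yx]; apply/nbhs_nrP; exists (r / 2 - nr (y - x)).
    by rewrite subr_gt0.
  by move=> z zy; exists x => //; apply: le_lt_trans (nr_tri y _ _) _; lra.
- by move=> x Kx; exists x => //; rewrite subrr nr0 divr_gt0.
have near_K y : closure V y -> exists2 x, K x & nr (y - x) < r.
  move=> /closure_nrP/(_ (r / 2)); rewrite divr_gt0// => /(_ isT)[z [x Kx zx] zy].
  by exists x => //; apply: le_lt_trans (nr_tri z _ _) _; rewrite nr_sym; lra.
split; last by move=> y /near_K[x Kx]; exact: Hn.
have [N HN] := compact_nr_bounded cK.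
apply: (subclosed_compact _ (@compact_nr_ball (N%:R + r))); first exact: closed_closure.
move=> y /near_K[x /HN xN yx] /=.
by have := nr_tri x y 0; rewrite !subr0; lra.
Qed.

Lemma dc_cont D g a b t A : dcurve D g a b -> a <= t <= b -> nbhs (g t) A ->
  exists2 e, 0 < e & forall s, a <= s <= b -> `|s - t| < e -> A (g s).
Proof.
move=> /dc_lip[L [L0 H]] tab /nbhs_nrP[r r0 rA].
have L1 : 0 < L + 1 by rewrite ltr_wpDl.
exists (r / (L + 1)); first by rewrite divr_gt0.
move=> s sab; rewrite ltr_pdivlMr// => st; apply: rA; apply: le_lt_trans (H s t sab tab) _.
have := normr_ge0 (s - t); lra.
Qed.

Lemma first_exit D g a b A : dcurve D g a b -> open A -> A (g a) -> ~ A (g b) ->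
  exists t, [/\ a <= t <= b, forall s, a <= s < t -> A (g s), ~ A (g t) & closure A (g t)].
Proof.
move=> gD oA Aa nAb; have ab := dc_le gD.
pose S := [set s | a <= s <= b /\ forall u, a <= u <= s -> A (g u)].
have Sa : S a.
  split; first by rewrite lexx ab.
  by move=> u /andP[au ua]; have -> : u = a by apply/eqP; rewrite eq_le au ua.
have hs : has_sup S by split; [exists a|exists b => s [/andP[]]].
pose t := sup S.
have at_ : a <= t by apply: ub_le_sup => //; case: hs.
have tb : t <= b by apply: ge_sup; [case: hs|move=> s [/andP[]]].
have tab : a <= t <= b by rewrite at_.
have before s : a <= s < t -> A (g s).
  move=> /andP[as_ st]; have ts : 0 < t - s by rewrite subr_gt0.
  have [u [_ Hu] us] := sup_adherent ts hs.
  by apply: Hu; rewrite as_ /=; apply: ltW; move: us; rewrite -/t; lra.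
have nAt : ~ A (g t).
  move=> At; have nA : nbhs (g t) A by exact: open_nbhs_nbhs.
  have [e e0 He] := dc_cont gD tab nA.
  have tb' : t < b.
    by rewrite lt_neqAle tb andbT; apply/negP => /eqP E; apply: nAb; rewrite -E.
  pose t' := Num.min (t + e / 2) b.
  have tt' : t < t' by rewrite /t' lt_min tb' andbT; lra.
  have t'e : t' <= t + e / 2 by rewrite /t' ge_min lexx.
  have t'b : t' <= b by rewrite /t' ge_min lexx orbT.
  have : S t'.
    split=> [|u /andP[au ut]]; first by rewrite t'b andbT; lra.
    have [ut'|tu] := ltP u t; first by apply: before; rewrite au.
    by apply: He; [rewrite au; lra|rewrite ger0_norm; lra].
  by case: hs => _ hub /(ub_le_sup hub); rewrite -/t; lra.
exists t; split=> // B nB; have [e e0 He] := dc_cont gD tab nB.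
have at' : a < t.
  by rewrite lt_neqAle at_ andbT; apply/negP => /eqP E; apply: nAt; rewrite -E.
pose s := Num.max a (t - e / 2).
have as_ : a <= s by rewrite /s le_max lexx.
have se : t - e / 2 <= s by rewrite /s le_max lexx orbT.
have st : s < t by rewrite /s gt_max at' /=; lra.
exists (g s); split; first by apply: before; rewrite as_.
by apply: He; [rewrite as_; lra|rewrite ltr0_norm; lra].
Qed.

(** An affine disc inside a ball around [x]. *)
Lemma near_chain D x e : open D -> D x -> 0 < e -> \forall y \near x, disc_chain D x y e.
Proof.
move=> oD Dx e0; have /nbhs_nrP[r r0 rD] : nbhs x D by exact: open_nbhs_nbhs.
have t0 := th_gt0 e0; have tc : toCC (th e) != 0.
  by rewrite -[0]toCC0 (inj_eq toCC_inj) gt_eqF.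
apply/nbhs_nrP; exists (r * th e); first by rewrite mulr_gt0.
move=> y yx; apply: chain_link; split; first exact: ltW.
pose p := (toCC (th e))^-1 *: (y - x).
exists (fun v => x + v *: p); split.
- apply/holo_discP => v v1; split.
    exists p => e' e'0; exists 1 => // u _.
    rewrite [x + _]addrC addrKA -scalerBl subrr nr0 mulr_ge0 ?nr_ge0 ?ltW//.
  apply: rD; rewrite [x + _]addrC addrK nrZ /p nrZ nrV nr_toCC ger0_norm ?ltW//.
  have pr : (th e)^-1 * nr (y - x) < r by rewrite mulrC ltr_pdivrMr.
  have p0 : 0 <= (th e)^-1 * nr (y - x) by rewrite mulr_ge0 ?nr_ge0 ?invr_ge0 ?ltW.
  by have := nr_ge0 v; nra.
- by rewrite scale0r addr0.
- by rewrite /p scalerA mulfV// scale1r addrC subrK.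
Qed.

Definition joined D x y := exists l, disc_chain D x y l.

Lemma joined_sym D x y : joined D x y -> joined D y x.
Proof. by move=> [l xy]; exists l; exact: chain_sym. Qed.

Lemma joined_trans D x y z : joined D x y -> joined D y z -> joined D x z.
Proof. by move=> [l xy] [l' yz]; exists (l + l'); exact: chain_trans yz. Qed.

Lemma near_joined D x : open D -> D x -> \forall y \near x, joined D x y.
Proof. by move=> oD Dx; apply: filterS (near_chain oD Dx ltr01) => y xy; exists 1. Qed.

(** The classes of [joined] are open, hence also relatively closed. *)
Lemma connected_joined D A x y : open D -> connected A -> A `<=` D -> A x -> A y -> joined D x y.
Proof.
move=> oD cA AD Ax Ay.
suff E : A `&` [set z | joined D x z] = A by move: Ay; rewrite -E => -[].
apply: cA.
  - by exists x; split=> //; exists 0; exact/chain_refl/AD.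
  - exists [set z | joined D x z] => //; rewrite openE => z xz.
    have [l xzl] := xz; have [_ Dz] := chain_in xzl.
    by apply: filterS (near_joined oD Dz) => w; exact: joined_trans.
  - exists (~` [set z | D z /\ ~ joined D x z]).
      apply: open_closedC; rewrite openE => z [Dz xz].
      have nD : nbhs z D by exact: open_nbhs_nbhs.
      apply: filterS2 nD (near_joined oD Dz) => w Dw zw; split=> // xw.
      by apply: xz; apply: joined_trans xw _; exact: joined_sym.
    apply/seteqP; split=> z [Az h]; split=> //=; first by move=> [].
    by apply: contrapT => nh; apply: h; split=> //; exact: AD.
Qed.

(** As the classes of [joined] are open, a pair of points that are not joined stays so
    under small perturbations; near a joined pair the bound is clear. *)
Lemma joined_bounded D K : open D -> compact K -> K `<=` D ->
  exists n : nat, forall x y, K x -> K y -> joined D x y -> exists2 l, disc_chain D x y l & l <= n%:R.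
Proof.
move=> oD cK KD.
pose P (n : nat) (p : 'CC[R]_d * 'CC[R]_d) :=
  joined D p.1 p.2 -> exists2 l, disc_chain D p.1 p.2 l & l <= n%:R.
have [n Hn] : exists n, forall p, (K `*` K) p -> P n p.
  apply: compact_nat; [|exact: compact_setX|].
    by move=> i j p ij H /H[l xy li]; exists l => //; apply: le_trans li _; rewrite ler_nat.
  move=> [x y] [/= /KD Dx /KD Dy].
  have nx := near_chain oD Dx ltr01; have ny := near_chain oD Dy ltr01.
  have [[l xy]|nxy] := pselect (joined D x y).
    have [n hn] := nat_bound (1 + (l + 1)); exists n.
    exists ([set x' | disc_chain D x x' 1], [set y' | disc_chain D y y' 1]) => //.
    move=> [x' y'] [/= xx' yy'] _; exists (1 + (l + 1)) => //.
    by apply: chain_trans (chain_sym xx') _; exact: chain_trans xy yy'.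
  exists 0%N; exists ([set x' | disc_chain D x x' 1], [set y' | disc_chain D y y' 1]) => //.
  move=> [x' y'] [/= xx' yy'] /= x'y'; exfalso; apply: nxy.
  apply: joined_trans (_ : joined D x x') _; first by exists 1.
  by apply: joined_trans x'y' _; exists 1; exact: chain_sym.
by exists n => x y Kx Ky; exact: (Hn (x, y)).
Qed.

Lemma near_optimal D x y : joined D x y ->
  exists2 L, disc_chain D x y L & forall l, disc_chain D x y l -> L <= l + 1.
Proof.
move=> [l0 xy0]; pose S := [set l | disc_chain D x y l].
have hs : has_inf S by split; [exists l0|exists 0 => l; exact: chain_ge0].
have [L SL Ll] := inf_adherent (@ltr01 R) hs.
exists L => // l xy; apply: le_trans (ltW Ll) _.
by rewrite lerD2r; apply: ge_inf => //; case: hs.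
Qed.

Lemma hyperbolic_sep D x y : kob_hyperbolic D -> D x -> D y -> x <> y ->
  exists2 e, 0 < e & forall l, disc_chain D x y l -> e <= l.
Proof.
move=> hD Dx Dy xy; apply: contrapT => H; apply: xy; apply: (hD _ _ Dx Dy).
apply/eqP; rewrite eq_le; apply/andP; split; last first.
  by apply: kobayashi_ge => l /chain_ge0; rewrite lee_fin.
apply/lee_addgt0Pr => e e0; rewrite add0e.
have [l xyl le] : exists2 l, disc_chain D x y l & l < e.
  apply: contrapT => G; apply: H; exists e => // l xyl.
  by rewrite leNgt; apply/negP => le; apply: G; exists l.
by apply: le_trans (kobayashi_le xyl) _; rewrite lee_fin ltW.
Qed.

(** Chains leaving a small ball around [o] cross its boundary sphere, on which
    the distance to [o] is bounded below by hyperbolicity and compactness. This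
    is Barth's theorem: the Kobayashi distance induces the Euclidean topology. *)
Lemma hyperbolic_nbhs D o V : open D -> kob_hyperbolic D -> D o -> nbhs o V ->
  exists2 e, 0 < e & \forall o' \near o, forall y l, disc_chain D o' y l -> ~ V y -> e <= l.
Proof.
move=> oD hD Do nV.
have nDV : nbhs o (D `&` V) by apply: filterI nV; exact: open_nbhs_nbhs.
have [B [oB oBo [cB BDV]]] : exists B, [/\ open B, B o & relcompact B (D `&` V°)].
  have [|||B [oB oB' rB]] := @relcompact_between [set o] (D `&` V°).
  - exact: compact_set1.
  - by apply: openI => //; exact: open_interior.
  - by move=> _ ->; split=> //; exact: nV.
  by exists B; split=> //; exact: oB'.
pose S := closure B `&` ~` B.
have cS : compact S by apply: compact_closedI => //; exact: open_closedC.
have [n Hn] : exists n : nat, forall s : 'CC[R]_d, S s -> forall l, disc_chain D o s l -> n.+1%:R^-1 <= l.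
  apply: compact_nat => //.
    move=> i j s ij H l os; apply: le_trans (H l os).
    by rewrite lef_pV2 ?posrE// ler_nat ltnS.
  move=> s [cBs nBs]; have [Ds _] := BDV s cBs.
  have [|e e0 He] := hyperbolic_sep hD Do Ds; first by move=> E; apply: nBs; rewrite -E.
  have e2 : 0 < e / 2 by rewrite divr_gt0.
  have [n hn] := nat_inv_bound e2; exists n.
  apply: filterS (near_chain oD Ds e2) => s' ss' l os'.
  apply: le_trans (ltW hn) _.
  have := He _ (chain_trans os' (chain_sym ss')); lra.
have : 0 < n.+1%:R^-1 :> R by rewrite invr_gt0.
move: (n.+1%:R^-1 : R) Hn => e Hn e0.
have e2 : 0 < e / 2 by rewrite divr_gt0.
exists (e / 2) => //.
apply: filterS (near_chain oD Do e2) => o' oo' y l o'y nVy.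
have [g [gD g0 gl]] := dc_exists (chain_trans oo' o'y).
have nBy : ~ B (g (e / 2 + l)).
  by rewrite gl => By; apply: nVy; have [_] := BDV _ (subset_closure By); exact: interior_subset.
have Bo : B (g 0) by rewrite g0.
have [t [/andP[t0 tl] _ nBt cBt]] := first_exit gD oB Bo nBy.
have := dc_chain_sub gD (lexx 0) t0 tl; rewrite g0 subr0 => /(Hn _ (conj cBt nBt)).
lra.
Qed.

End Topology.

(** * Almost-geodesics and visibility of regions *)

Section AlmostGeodesics.
Context {R : realType} {d : nat}.
Implicit Types (D K A B U V : set 'CC[R]_d) (x y z w : 'CC[R]_d) (g h : R -> 'CC[R]_d).
Implicit Types (a b c l s t r e : R).

(** The upper bound in the definition of a (1,1)-almost-geodesic is automatic,
    because the curve itself is a chain of discs; only the lower bound has to be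
    required. *)
Definition ageo D g a b := dcurve D g a b /\
  forall s t l, a <= s -> s <= t -> t <= b -> disc_chain D (g s) (g t) l -> t - s <= l + 1.

Lemma ageo_sub D g a b s t : ageo D g a b -> a <= s -> s <= t -> t <= b -> ageo D g s t.
Proof.
move=> [gD gq] as_ st tb; split; first exact: dc_sub gD as_ st tb.
by move=> u v l su uv vt; apply: gq => //; [exact: le_trans su|exact: le_trans tb].
Qed.

Lemma ageo_rev D g a b : ageo D g a b -> ageo D (fun t => g (- t)) (- b) (- a).
Proof.
move=> [gD gq]; split; first exact: dc_rev.
move=> s t l bs st ta /chain_sym ts.
have -> : t - s = - s - - t by lra.
by apply: gq ts; lra.
Qed.

Lemma ageo_shift D g a b c : ageo D g a b -> ageo D (fun t => g (t + c)) (a - c) (b - c).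
Proof.
move=> [gD gq]; split; first exact: dc_shift.
move=> s t l bs st ta H.
have -> : t - s = t + c - (s + c) by lra.
by apply: gq H; lra.
Qed.

Lemma ageo_exists D x y : joined D x y -> exists g L, [/\ ageo D g 0 L, g 0 = x, g L = y &
  forall l, disc_chain D x y l -> L <= l + 1].
Proof.
move=> /near_optimal[L xyL opt]; have [g [gD g0 gL]] := dc_exists xyL.
exists g, L; split=> //; split=> // s t l s0 st tL H.
have h1 := dc_chain_sub gD (lexx 0) s0 (le_trans st tL).
have h2 := dc_chain_sub gD (le_trans s0 st) tL (lexx L).
rewrite g0 in h1; rewrite gL in h2.
by have := opt _ (chain_trans h1 (chain_trans H h2)); lra.
Qed.

Lemma ageo_almost D g b : ageo D g 0 b -> almost_geodesic D 1 `[0, b] g.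
Proof.
move=> [gD gq]; split.
- by move=> t /=; rewrite in_itv /=; exact: dc_in gD.
- exact: dc_abs_continuous gD.
- move=> s t /=; rewrite !in_itv /= => /andP[s0 sb] /andP[t0 tb].
  have key u v : 0 <= u -> u <= v -> v <= b ->
      (forall l, disc_chain D (g u) (g v) l -> `|v - u| - 1 <= l) /\ disc_chain D (g u) (g v) `|v - u|.
    move=> u0 uv vb; rewrite ger0_norm ?subr_ge0//.
    split; first by move=> l /(gq u v l u0 uv vb); lra.
    exact: dc_chain_sub gD u0 uv vb.
  have [K1 K2] : (forall l, disc_chain D (g s) (g t) l -> `|t - s| - 1 <= l) /\
      disc_chain D (g s) (g t) `|t - s|.
    have [st|/ltW ts] := leP s t; first exact: key.
    have [k1 k2] := key t s t0 ts sb; rewrite distrC.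
    by split; [move=> l /chain_sym; exact: k1|exact: chain_sym].
  split; first by apply: kobayashi_ge => l /K1; rewrite lee_fin.
  by apply: le_trans (kobayashi_le K2) _; rewrite lee_fin lerDl.
- have [S HS] := dc_deriv gD.
  by apply: (finite_ae (S := S)) => t tS /=; rewrite in_itv /= => t0b; exact: HS.
Qed.

Lemma compact_nbhd V x : open V -> V x -> exists K, [/\ compact K, K `<=` V & nbhs x K].
Proof.
move=> oV Vx; have [|||B [oB xB [cB BV]]] := @relcompact_between _ _ [set x] V => //.
- exact: compact_set1.
- by move=> _ ->.
exists (closure B); split=> //; apply: filterS (@subset_closure _ B) _.
by apply: open_nbhs_nbhs; split=> //; exact: xB.
Qed.

(** Such a curve crosses the compact frontiers of [A] and of [B]. Near a pair of
    boundary points [weak_visible] supplies a compact set, and near any other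
    pair of frontier points a compact neighbourhood of one of them, or nothing,
    suffices; compactness of the product makes the choice uniform. *)
Lemma visible_compact D U A B : open D ->
  (forall p q, (U `&` boundary D) p -> (U `&` boundary D) q -> p <> q -> weak_visible D p q) ->
  open A -> open B -> relcompact A B -> relcompact B U ->
  exists K, [/\ compact K, K `<=` D & forall g a b, ageo D g a b -> A (g a) -> ~ B (g b) ->
    exists2 t, a <= t <= b & K (g t)].
Proof.
move=> oD vis oA oB [cA AB] [cB BU].
pose SA := closure A `&` ~` A; pose SB := closure B `&` ~` B.
have cSA : compact SA by apply: compact_closedI => //; exact: open_closedC.
have cSB : compact SB by apply: compact_closedI => //; exact: open_closedC.
have oC : open (~` closure D) by apply: closed_openC; exact: closed_closure.
pose I := {K : set 'CC[R]_d | compact K /\ K `<=` D}.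
pose mk K (H : compact K /\ K `<=` D) : I := exist (fun K => compact K /\ K `<=` D) K H.
pose hit (K : I) (p : 'CC[R]_d * 'CC[R]_d) := forall g a b, ageo D g a b ->
  g a = p.1 -> g b = p.2 -> exists2 t, a <= t <= b & sval K (g t).
have [K0 K0E] : exists K0 : I, sval K0 = set0.
  have H0 : compact (@set0 'CC[R]_d) /\ @set0 'CC[R]_d `<=` D by split; [exact: compact0|].
  by exists (mk _ H0).
have [||||||K HK] := @compact_directed _ I (fun i j : I => sval i `<=` sval j) K0 (SA `*` SB) hit.
- by move=> K.
- by move=> i j k; exact: subset_trans.
- move=> [K [cK KD]] [L [cL LD]].
  have H : compact (K `|` L) /\ K `|` L `<=` D.
    by split; [exact: compactU|move=> x []; [exact: KD|exact: LD]].
  by exists (mk _ H); split=> x; [left|right].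
- move=> K L p KL H g a b gg ga gb; have [t tab Kt] := H g a b gg ga gb.
  by exists t => //; exact: KL.
- exact: compact_setX.
- move=> [p q] [[/= cAp nAp] [cBq nBq]].
  have [Dp|nDp] := pselect (D p).
    have [K [cK KD nK]] := compact_nbhd oD Dp.
    exists (mk K (conj cK KD)); exists (K, setT); first by split=> //; exact: filterT.
    move=> [p' q'] [/= Kp' _] g a b [gD _] /= ga _.
    by exists a; [rewrite lexx (dc_le gD)|rewrite ga].
  have [Dq|nDq] := pselect (D q).
    have [K [cK KD nK]] := compact_nbhd oD Dq.
    exists (mk K (conj cK KD)); exists (setT, K); first by split=> //; exact: filterT.
    move=> [p' q'] [/= _ Kq'] g a b [gD _] /= _ gb.
    by exists b; [rewrite lexx (dc_le gD)|rewrite gb].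
  have [cDp|ncDp] := pselect (closure D p); last first.
    exists K0; exists (~` closure D, setT).
      split; last exact: filterT.
      exact: open_nbhs_nbhs (conj oC ncDp).
    move=> [p' q'] [/= np _] g a b [gD _] /= ga _; exfalso; apply: np; rewrite -ga.
    by apply: subset_closure; apply: (dc_in gD); rewrite lexx (dc_le gD).
  have [cDq|ncDq] := pselect (closure D q); last first.
    exists K0; exists (setT, ~` closure D).
      split; first exact: filterT.
      exact: open_nbhs_nbhs (conj oC ncDq).
    move=> [p' q'] [/= _ nq] g a b [gD _] /= _ gb; exfalso; apply: nq; rewrite -gb.
    by apply: subset_closure; apply: (dc_in gD); rewrite lexx (dc_le gD).
  have bp : (U `&` boundary D) p.
    split; first by apply: BU; apply: subset_closure; exact: AB.
    by split=> // /interior_subset.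
  have bq : (U `&` boundary D) q.
    by split; [exact: BU|split=> // /interior_subset].
  have pq : p <> q by move=> E; apply: nBq; rewrite -E; exact: AB.
  have [Vp [Vq [K [nVp nVq _ [cK KD] H]]]] := vis p q bp bq pq 1 ler01.
  exists (mk K (conj cK KD)); exists (Vp, Vq) => //.
  move=> [p' q'] [/= Vp' Vq'] g a b gg /= ga gb.
  have gg' := ageo_shift a gg; rewrite subrr in gg'.
  have ab := dc_le gg.1.
  have ba0 : 0 <= b - a by rewrite subr_ge0.
  have [||_ [[t /= t0 <-] Kt]] := H _ _ ba0 (ageo_almost gg').
  - split; first by rewrite add0r ga.
    by apply: (dc_in gg.1); rewrite add0r lexx.
  - split; first by rewrite subrK gb.
    by apply: (dc_in gg.1); rewrite subrK lexx ab.
  - exists (t + a) => //; move: t0; rewrite in_itv /= => /andP[? ?].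
    by apply/andP; split; lra.
exists (sval K); have [cK KD] := svalP K; split=> // g a b gg Aa nBb.
have Ba : B (g a) by apply: AB; exact: subset_closure.
have [t [/andP[at_ tb] _ nBt cBt]] := first_exit gg.1 oB Ba nBb.
have gt := ageo_sub gg (lexx a) at_ tb.
have nAt : ~ A (g t) by move=> At; apply: nBt; apply: AB; exact: subset_closure.
have [s [/andP[as_ st] _ nAs cAs]] := first_exit gt.1 oA Aa nAt.
have gst := ageo_sub gt as_ st (lexx t).
have [u /andP[su ut] Ku] := HK (g s, g t) (conj (conj cAs nAs) (conj cBt nBt)) g s t gst erefl erefl.
by exists u => //; apply/andP; split; lra.
Qed.

End AlmostGeodesics.

(** * Localisation along almost-geodesics *)

Section Localization.
Context {R : realType} {d : nat}.
Implicit Types (D K A B U V : set 'CC[R]_d) (x y z w o : 'CC[R]_d) (g h : R -> 'CC[R]_d).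
Implicit Types (a b c l s t r e : R).

Lemma chain_mono D D' x y l : D `<=` D' -> disc_chain D x y l -> disc_chain D' x y l.
Proof.
move=> DD'; have lm u v k : link D u v k -> link D' u v k.
  move=> [k0 [f [fD fu fv]]]; split=> //; exists f; split=> //.
  by move=> p /fD[df Df]; split=> //; exact: DD'.
elim=> {x y l} [x y l /lm xy|x y z l l' /lm xy _]; first exact: chain_link.
exact: chain_cons.
Qed.

(** The part of the disc that is known to lie in [U] is rescaled to a full disc
    in [U `&` D]; the segment becomes longer because the disc becomes smaller. *)
Lemma link_shrink D U (f : CC R -> 'CC[R]_d) r s t : holo_disc D f -> 0 < r -> r < 1 ->
  (forall v : CC R, nr v < r -> U (f v)) ->
  0 <= s -> 0 <= t -> th s <= r * th t ->
  link (U `&` D) (f 0) (f (toCC (th s))) t.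
Proof.
move=> fD r0 r1 fU s0 t0 st; have ts := th_ge0 s0; have tt := th_ge0 t0.
pose k := th s / th t.
have kE : k * th t = th s.
  have [ty0|ty0] := eqVneq (th t) 0; last by rewrite /k divfK.
  by apply/eqP; rewrite eq_le ty0 mulr0 ts /=; move: st; rewrite ty0 mulr0.
have k0 : 0 <= k by rewrite divr_ge0.
have kr : k <= r.
  have [ty0|ty0] := eqVneq (th t) 0; first by rewrite /k ty0 invr0 mulr0 ltW.
  by rewrite /k ler_pdivrMr// lt_def ty0.
have nk : nr (toCC k) = k by rewrite nr_toCC ger0_norm.
split=> //; exists (f \o (fun v => toCC k * v)); split.
- have /holo_discP kD : holo_disc D (f \o (fun v => toCC k * v)).
    by apply: holo_disc_scale => //; rewrite nk; lra.
  apply/holo_discP => v v1; have [df Df] := kD v v1; split=> //; split=> //.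
  apply: fU; rewrite nrM nk; have := nr_ge0 v; nra.
- by rewrite /= mulr0.
- by rewrite /= -toCCM kE.
Qed.

Lemma chain_in_disc D (f : CC R -> 'CC[R]_d) (v : CC R) : holo_disc D f -> nr v < 1 ->
  disc_chain D (f 0) (f v) (ath (nr v)).
Proof.
move=> fD v1; have v0 : nr (0 : CC R) < 1 by rewrite nr0.
have := link_poincare fD v0 v1.
have -> : poincare 0 v = ath (nr v); last exact: chain_link.
rewrite /poincare conjC0 mul0r subr0 divr1 sub0r.
by rewrite -[complex.Re _]/(nr (- v)) nrN.
Qed.

(** A point of the disc outside [U] would be at Kobayashi distance at most its
    hyperbolic distance from the centre. *)
Lemma disc_stays D U (f : CC R -> 'CC[R]_d) e : holo_disc D f -> 0 < e ->
  (forall y l, ~ U y -> disc_chain D (f 0) y l -> e <= l) ->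
  forall v : CC R, nr v < th e -> U (f v).
Proof.
move=> fD e0 H v ve; apply: contrapT => nU.
have v1 : nr v < 1 by apply: lt_trans ve (th_lt1 e).
have h := H _ _ nU (chain_in_disc fD v1).
have v0 := nr_ge0 v.
have := th_homo h; rewrite athK//; lra.
Qed.

(** Both sides are additive along the curve, so it suffices to treat short
    pieces inside one disc. *)
Lemma local_to_global D D' (G : R -> R) g a b e : 0 < e -> dcurve D g a b ->
  (forall f s t, a <= s -> s <= t -> t <= b -> t - s <= e -> holo_disc D f ->
    (forall u, s <= u <= t -> g u = f (toCC (th (u - s)))) ->
    exists2 l, disc_chain D' (g s) (g t) l & l <= G t - G s) ->
  exists2 l, disc_chain D' (g a) (g b) l & l <= G b - G a.
Proof.
move=> e0 gD; elim: gD => {a b} [a b f ab fD gf|a m b am IH1 mb IH2] H; last first.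
  have [a1 m1] := (dc_le am, dc_le mb).
  have [l1 j1 h1] := IH1 (fun f s t as_ st tm => H f s t as_ st (le_trans tm m1)).
  have [l2 j2 h2] := IH2 (fun f s t ms st tb => H f s t (le_trans a1 ms) st tb).
  by exists (l1 + l2); [exact: chain_trans j1 j2|lra].
have step s t : a <= s -> s <= t -> t <= b -> t - s <= e ->
    exists2 l, disc_chain D' (g s) (g t) l & l <= G t - G s.
  move=> as_ st tb ts; apply: (H (f \o moebius (toCC (th (s - a))))) => //.
    by apply: holo_disc_moebius => //; exact: nr_th.
  move=> u /andP[su ut]; rewrite gf; last by apply/andP; split; lra.
  by rewrite /= moebius_toCC; congr (f (toCC (th _))); lra.
have [N HN] := nat_bound ((b - a) / e).
have {HN} : b - a <= N%:R * e by rewrite -ler_pdivrMr.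
suff chain n s : a <= s -> s <= b -> b - s <= n%:R * e ->
    exists2 l, disc_chain D' (g s) (g b) l & l <= G b - G s.
  by move=> hN; exact: (chain N a).
elim: n s => [|n IH] s as_ sb.
  by rewrite mul0r => bs; apply: step => //; lra.
have [small _|big hn] := leP (b - s) e; first exact: step.
have [|||l2 j2 h2] := IH (s + e).
- lra.
- lra.
- by move: hn; rewrite -natr1; lra.
have [||||l1 j1 h1] := step s (s + e).
- exact: as_.
- lra.
- lra.
- lra.
by exists (l1 + l2); [exact: chain_trans j1 j2|lra].
Qed.

Section Region.
Variables (D U A B : set 'CC[R]_d).
Hypotheses (oD : open D) (cD : connected D) (hD : kob_hyperbolic D) (oU : open U).
Hypothesis vis : forall p q,
  (U `&` boundary D) p -> (U `&` boundary D) q -> p <> q -> weak_visible D p q.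
Hypotheses (oA : open A) (oB : open B) (rAB : relcompact A B) (rBU : relcompact B U).

Let notU_notB y : ~ U y -> ~ B y.
Proof. by move=> nU By; apply: nU; apply: rBU.2; exact: subset_closure. Qed.

Let all_joined x y : D x -> D y -> joined D x y.
Proof. by move=> Dx Dy; exact: (connected_joined oD cD). Qed.

(** A short chain from [A] out of [U] would meet a fixed compact subset of [D],
    near each point of which one of the two ends is excluded. Every chain of
    length at most [1] gives an almost-geodesic, so near-optimality is free
    here. *)
Lemma dist_lower : exists2 e, 0 < e & forall z y l, A z -> ~ U y -> disc_chain D z y l -> e <= l.
Proof.
have [K [cK KD HK]] := visible_compact oD vis oA oB rAB rBU.
have [n Hn] : exists n : nat, forall o : 'CC[R]_d, K o -> forall z y l l', A z -> ~ U y ->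
    disc_chain D o z l -> disc_chain D o y l' -> n.+1%:R^-1 <= l \/ n.+1%:R^-1 <= l'.
  apply: compact_nat => //.
    move=> i j o ij H z y l l' Az nUy oz oy.
    have le : j.+1%:R^-1 <= i.+1%:R^-1 :> R by rewrite lef_pV2 ?posrE// ler_nat ltnS.
    by have [?|?] := H z y l l' Az nUy oz oy; [left|right]; exact: le_trans le _.
  move=> o Ko; have Do := KD _ Ko.
  have [Uo|nUo] := pselect (U o).
    have [e e0 He] := hyperbolic_nbhs oD hD Do (open_nbhs_nbhs (conj oU Uo)).
    have [n hn] := nat_inv_bound e0; exists n; apply: filterS He => o' He z y l l' _ nUy _ o'y.
    by right; apply: le_trans (ltW hn) _; exact: He o'y nUy.
  have oCA : open (~` closure A) by apply: closed_openC; exact: closed_closure.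
  have nAo : ~ closure A o.
    by move=> cAo; apply: (notU_notB nUo); exact: rAB.2.
  have [e e0 He] := hyperbolic_nbhs oD hD Do (open_nbhs_nbhs (conj oCA nAo)).
  have [n hn] := nat_inv_bound e0; exists n; apply: filterS He => o' He z y l l' Az _ o'z _.
  left; apply: le_trans (ltW hn) _; apply: He o'z _.
  by apply; exact: subset_closure.
have : 0 < n.+1%:R^-1 :> R by rewrite invr_gt0.
move: (n.+1%:R^-1 : R) Hn => e0 Hn e00.
exists (Num.min 1 e0); first by rewrite lt_min ltr01.
move=> z y l Az nUy zy; rewrite ge_min.
have [l1|/ltW l1] := leP 1 l; first by [].
have [g [gD g0 gl]] := dc_exists zy.
have gg : ageo D g 0 l.
  by split=> // s t k s0 st tl /chain_ge0; lra.
have [||t /andP[t0 tl] Kt] := HK g 0 l gg; first by rewrite g0.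
  by rewrite gl; exact: notU_notB.
have h1 := dc_chain_sub gD (lexx 0) t0 tl; rewrite g0 in h1.
have h2 := dc_chain_sub gD t0 tl (lexx l); rewrite gl in h2.
apply/orP; right.
by have [] := Hn _ Kt z y _ _ Az nUy (chain_sym h1) h2; lra.
Qed.

(** An almost-geodesic from [A] out of [U] passes within bounded distance of the
    base point [o], so its first part is a route to [o] up to a constant. *)
Lemma dist_growth o : D o -> exists2 c, 0 <= c & forall z y l, A z -> ~ U y -> disc_chain D z y l ->
  exists2 l', disc_chain D o z l' & l' <= l + c.
Proof.
move=> Do; have [K [cK KD HK]] := visible_compact oD vis oA oB rAB rBU.
have [n Hn] : exists n : nat, forall x y, (K `|` [set o]) x -> (K `|` [set o]) y ->
    joined D x y -> exists2 l, disc_chain D x y l & l <= n%:R.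
  apply: joined_bounded => //; first by apply: compactU => //; exact: compact_set1.
  by move=> x [/KD//|->].
exists (n%:R + 1); first by rewrite addr_ge0.
move=> z y l Az nUy zy.
have [g [L [gg g0 gL opt]]] : exists g L, [/\ ageo D g 0 L, g 0 = z, g L = y &
    forall l, disc_chain D z y l -> L <= l + 1] by apply: ageo_exists; exists l.
have [||t /andP[t0 tL] Kt] := HK g 0 L gg; first by rewrite g0.
  by rewrite gL; exact: notU_notB.
have [k ok kn] : exists2 k, disc_chain D o (g t) k & k <= n%:R.
  by apply: Hn; [right|left|apply: all_joined => //; exact: KD].
have h1 := dc_chain_sub gg.1 (lexx 0) t0 tL; rewrite g0 subr0 in h1.
exists (k + t); first by apply: chain_trans ok _; exact: chain_sym.
have := opt l zy; lra.
Qed.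

(** Along an almost-geodesic inside [A] the distance to the complement of [U]
    grows at least linearly away from the time [t0] at which the curve is closest to a
    base point. The localisation error is therefore at most a multiple of the
    integral of [exp (- |t - t0|)], whatever the length of the curve. *)
Lemma almost_geodesic_localizes : exists2 C, 0 <= C & forall g a b, ageo D g a b ->
  (forall t, a <= t <= b -> A (g t)) ->
  exists2 l, disc_chain (U `&` D) (g a) (g b) l & l <= b - a + C.
Proof.
have [[x0 Dx0]|nD] := pselect (D !=set0); last first.
  exists 0 => // g a b [gD _] _; exfalso; apply: nD; exists (g a).
  by apply: (dc_in gD); rewrite lexx (dc_le gD).
have [e0 e00 He0] := dist_lower.
have [c c0 Hc] := dist_growth Dx0.
have [h [M [h0 M0 HM]]] := th_shrink (th_gt0 e00) (th_lt1 e0).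
pose E := 4 * M * expR (2 * (c + 1)).
have E0 : 0 < E by rewrite !mulr_gt0 ?expR_gt0.
exists (2 * E); first by rewrite mulr_ge0 ?ltW.
move=> g a b gg gA; have [gD gq] := gg; have ab := dc_le gD.
have Dg t : a <= t <= b -> D (g t) by exact: dc_in gD.
pose S := [set l | exists2 t, a <= t <= b & disc_chain D x0 (g t) l].
have hS : has_inf S.
  split; last by exists 0 => l [t _]; exact: chain_ge0.
  have aab : a <= a <= b by rewrite lexx.
  by have [l ol] := all_joined Dx0 (Dg a aab); exists l, a.
have [l0 [t0 t0ab ot0] l0opt] := inf_adherent (@ltr01 R) hS.
have opt t l : a <= t <= b -> disc_chain D x0 (g t) l -> l0 <= l + 1.
  move=> tab ol; apply: le_trans (ltW l0opt) _; rewrite lerD2r; apply: ge_inf.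
    by case: hS.
  by exists t.
have sep t l : a <= t <= b -> disc_chain D x0 (g t) l -> `|t - t0| <= 2 * l + 2.
  move=> tab ol; have l0l := opt t l tab ol.
  have j := chain_trans (chain_sym ol) ot0.
  have [ /andP[at_ tb] /andP[at0 t0b]] := (tab, t0ab).
  have [tt0|/ltW t0t] := leP t t0.
    by rewrite distrC ger0_norm ?subr_ge0//; have := gq t t0 _ at_ tt0 t0b j; lra.
  by rewrite ger0_norm ?subr_ge0//; have := gq t0 t _ at0 t0t tb (chain_sym j); lra.
(* lower bound for the distance from [g t] to the complement of [U] *)
pose dl t := Num.max e0 (`|t - t0| / 2 - (c + 1)).
have dl0 t : 0 < dl t by rewrite lt_max e00.
have dlP t y l : a <= t <= b -> ~ U y -> disc_chain D (g t) y l -> dl t <= l.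
  move=> tab nUy ty; rewrite ge_max (He0 _ _ _ (gA t tab) nUy ty) /=.
  have [l' ol' l'l] := Hc _ _ _ (gA t tab) nUy ty.
  have := sep t l' tab ol'; lra.
have tail t : M * (1 - th (dl t)) <= E / 2 * expR (- `|t - t0|).
  have : `|t - t0| / 2 - (c + 1) <= dl t by rewrite le_max lexx orbT.
  move=> h1; have h2 := th_tail (dl t).
  have h3 : expR (- (2 * dl t)) <= expR (2 * (c + 1)) * expR (- `|t - t0|).
    by rewrite -expRD ler_expR; lra.
  have -> : E / 2 * expR (- `|t - t0|) = M * (2 * (expR (2 * (c + 1)) * expR (- `|t - t0|))).
    by rewrite /E; field.
  by rewrite ler_pM2l//; lra.
have step f s t : a <= s -> s <= t -> t <= b -> t - s <= h -> holo_disc D f ->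
    (forall u, s <= u <= t -> g u = f (toCC (th (u - s)))) ->
    exists2 l, disc_chain (U `&` D) (g s) (g t) l &
      l <= (t - s) + E / 2 * expR (- `|s - t0|) * (t - s).
  move=> as_ st tb ts fD gf.
  have sab : a <= s <= b by rewrite as_ (le_trans st).
  have fs : f 0 = g s by rewrite gf ?lexx// subrr th0 toCC0.
  have ft : f (toCC (th (t - s))) = g t by rewrite gf// lexx st.
  have ts0 : 0 <= t - s by rewrite subr_ge0.
  have re : th e0 <= th (dl s) by apply: th_homo; rewrite le_max lexx.
  have key := HM _ _ re (th_lt1 _) ts0 ts.
  exists (t - s + M * (1 - th (dl s)) * (t - s)); last first.
    by rewrite lerD2l ler_wpM2r.
  apply: chain_link; rewrite -fs -ft; apply: (link_shrink fD _ _ _ ts0 _ key).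
  - exact: th_gt0.
  - exact: th_lt1.
  - by apply: (disc_stays fD (dl0 s)) => y l nUy; rewrite fs; exact: dlP.
  - have := th_lt1 (dl s) => r1; rewrite addr_ge0// !mulr_ge0//; lra.
have [/andP[at0 t0b]] := t0ab.
have h'0 : 0 < Num.min h 1 by rewrite lt_min h0 ltr01.
have [l1 j1 H1] : exists2 l, disc_chain (U `&` D) (g a) (g t0) l &
    l <= (t0 + E * expR (t0 - t0)) - (a + E * expR (a - t0)).
  apply: (local_to_global (G := fun t => t + E * expR (t - t0)) h'0 (dc_sub gD (lexx a) at0 t0b)).
  move=> f s t as_ st tt0; rewrite le_min => /andP[ts _] fD gf.
  have [l j hl] := step f s t as_ st (le_trans tt0 t0b) ts fD gf.
  exists l => //; apply: le_trans hl _.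
  rewrite ler0_norm ?subr_le0; last exact: le_trans tt0.
  have := expR_ge1Dx (t - s); have -> : expR (t - t0) = expR (s - t0) * expR (t - s).
    by rewrite -expRD; congr expR; lra.
  rewrite opprK; have := expR_gt0 (s - t0); move: (expR (s - t0)) (expR (t - s)) => p q p0 hq.
  have : E * p * (t - s) <= E * p * (q - 1) by apply: ler_wpM2l; [rewrite mulr_ge0 ?ltW|lra].
  have : 0 <= E * p * (t - s) by rewrite mulr_ge0 ?subr_ge0// mulr_ge0 ?ltW.
  lra.
have [l2 j2 H2] : exists2 l, disc_chain (U `&` D) (g t0) (g b) l &
    l <= (b - E * expR (t0 - b)) - (t0 - E * expR (t0 - t0)).
  apply: (local_to_global (G := fun t => t - E * expR (t0 - t)) h'0 (dc_sub gD at0 t0b (lexx b))).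
  move=> f s t ts0 st tb; rewrite le_min => /andP[ts ts1] fD gf.
  have [l j hl] := step f s t (le_trans at0 ts0) st tb ts fD gf.
  exists l => //; apply: le_trans hl _.
  rewrite ger0_norm ?subr_ge0// opprB.
  have := expR_ge1Dx (t - s); have -> : expR (t0 - s) = expR (t0 - t) * expR (t - s).
    by rewrite -expRD; congr expR; lra.
  have -> : E / 2 * (expR (t0 - t) * expR (t - s)) * (t - s) =
     E * expR (t0 - t) * (expR (t - s) * (t - s) / 2) by field.
  have := expR_gt0 (t0 - t); move: (expR (t0 - t)) (expR (t - s)) => p q p0 hq.
  (* [1 - exp (- u) >= u / 2] for [u] in [0, 1] *)
  have q1 : q * (t - s) / 2 <= q - 1.
    have : (1 + (t - s)) * (1 - (t - s) / 2) <= q * (1 - (t - s) / 2).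
      by apply: ler_wpM2r; lra.
    by nra.
  have : E * p * (q * (t - s) / 2) <= E * p * (q - 1).
    by apply: ler_wpM2l => //; rewrite mulr_ge0 ?ltW.
  lra.
exists (l1 + l2); first exact: chain_trans j1 j2.
rewrite subrr expR0 in H1 H2.
have := expR_gt0 (a - t0); have := expR_gt0 (t0 - b) => p1 p2.
have : 0 < E * expR (a - t0) by rewrite mulr_gt0.
have : 0 < E * expR (t0 - b) by rewrite mulr_gt0.
lra.
Qed.

End Region.

End Localization.

(** * The localisation theorem *)

Section Exit.
Context {R : realType} {d : nat}.
Variables (D U A B A' K : set 'CC[R]_d).
Hypotheses (oB : open B) (AB : A `<=` B) (BA' : closure B `<=` A').
Hypothesis hitK : forall (g : R -> 'CC[R]_d) (a b : R), ageo D g a b -> A (g a) -> ~ B (g b) ->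
  exists2 t, a <= t <= b & K (g t).
Variable C : R.
Hypothesis localK : forall (g : R -> 'CC[R]_d) (a b : R), ageo D g a b ->
  (forall t, a <= t <= b -> A' (g t)) ->
  exists2 l, disc_chain (U `&` D) (g a) (g b) l & l <= b - a + C.

(** The compact set gives a point up to which the curve has not left [B] and can
    be localised. Applied at both ends of a curve that leaves [B], this reduces
    the problem to joining two points of a compact subset of [U `&` D]. *)
Lemma localized_exit (g : R -> 'CC[R]_d) (a b : R) : ageo D g a b -> A (g a) -> ~ B (g b) ->
  exists s, [/\ a <= s <= b, (K `&` closure B) (g s) &
    exists2 l, disc_chain (U `&` D) (g a) (g s) l & l <= s - a + C].
Proof.
move=> gg Aa nBb.
have [t [/andP[at_ tb] before nBt cBt]] := first_exit gg.1 oB (AB Aa) nBb.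
have inB u : a <= u <= t -> closure B (g u).
  move=> /andP[au ut]; have [ut'|tu] := ltP u t.
    by apply: subset_closure; apply: before; rewrite au.
  by have -> : u = t by apply/eqP; rewrite eq_le ut.
have gt := ageo_sub gg (lexx a) at_ tb.
have [s /andP[as_ st] Ks] := hitK gt Aa nBt.
exists s; split.
- by rewrite as_ (le_trans st).
- by split; [exact: Ks|apply: inB; rewrite as_].
- apply: localK; first exact: ageo_sub gt (lexx a) as_ st.
  by move=> u /andP[au us]; apply: BA'; apply: inB; rewrite au (le_trans us).
Qed.

End Exit.

Theorem theorem1p3 (R : realType) (d : nat) (hd : (1 <= d)%N)
    (Omega U : set 'CC[R]_d)
    (Omega_dom : is_domain Omega) (Omega_hyp : kob_hyperbolic Omega)
    (U_open : open U)
    (U_bd : U `&` boundary Omega !=set0)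
    (U_bd_gt1 : exists p q : 'CC[R]_d,
       [/\ (U `&` boundary Omega) p, (U `&` boundary Omega) q & p <> q])
    (U_vis : forall p q : 'CC[R]_d,
       (U `&` boundary Omega) p -> (U `&` boundary Omega) q -> p <> q ->
       weak_visible Omega p q)
    (W : set 'CC[R]_d) (W_open : open W)
    (W_meets : W `&` Omega !=set0) (W_rel : relcompact W U) :
  exists2 C : R, 0 < C &
    forall z w : 'CC[R]_d, (W `&` Omega) z -> (W `&` Omega) w ->
      connected_component (U `&` Omega) z w ->
      (kobayashi (U `&` Omega) z w <= kobayashi Omega z w + C%:E)%E.
Proof.
have [_ oD cD] := Omega_dom.
have [cW WU] := W_rel.
have [W1 [oW1 WW1 rW1]] := relcompact_between cW U_open WU.
have [W2 [oW2 W12 rW2]] := relcompact_between rW1.1 U_open rW1.2.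
have [W3 [oW3 W23 rW3]] := relcompact_between rW2.1 U_open rW2.2.
have rel1 : relcompact W W1 by split.
have rel2 : relcompact W2 W3 by split=> //; exact: rW2.1.
have [K [cK KD HK]] := visible_compact oD U_vis W_open oW1 rel1 rW1.
have [C C0 HC] := almost_geodesic_localizes oD cD Omega_hyp U_open U_vis oW2 oW3 rel2 rW3.
pose K' := K `&` closure W1.
have oUD : open (U `&` Omega) by exact: openI.
have cK' : compact K' by apply: compact_closedI => //; exact: closed_closure.
have K'U : K' `<=` U `&` Omega by move=> x [Kx Wx]; split; [exact: rW1.2|exact: KD].
have [n Hn] := joined_bounded oUD cK' K'U.
have sWW1 : W `<=` W1 by move=> x Wx; apply: WW1; exact: subset_closure.
have exit := localized_exit oW1 sWW1 W12 HK HC.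
have C1 : 0 < 2 * C + n%:R + 1 by rewrite ltr_wpDl// addr_ge0// mulr_ge0.
(* both localised ends, the gap inside [K'], and the loss of near-optimality *)
exists (2 * C + n%:R + 1) => // z w [Wz Dz] [Ww Dw] zw.
have Jzw : joined (U `&` Omega) z w.
  have cc := @component_connected _ (U `&` Omega) z.
  apply: (connected_joined oUD cc) => //; first exact: connected_component_sub.
  by apply: connected_component_refl; split; [apply: WU; exact: subset_closure|exact: Dz].
have JDzw : joined Omega z w by case: Jzw => l zwl; exists l; apply: chain_mono zwl => x [].
have [g [L [gg g0 gL opt]]] := ageo_exists JDzw.
have L0 := dc_le gg.1.
suff [l zwl hl] : exists2 l, disc_chain (U `&` Omega) z w l & l <= L + (2 * C + n%:R).
  apply: le_trans (kobayashi_le zwl) _.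
  apply: (@le_trans _ _ ((L - 1)%:E + (2 * C + n%:R + 1)%:E)%E).
    by rewrite -EFinD lee_fin; lra.
  rewrite leeD2r//; apply: kobayashi_ge => k /opt; rewrite lee_fin; lra.
have [stay|] := pselect (forall t, 0 <= t <= L -> W1 (g t)).
  have [l j hl] : exists2 l, disc_chain (U `&` Omega) (g 0) (g L) l & l <= L - 0 + C.
    by apply: HC => // t /stay W1t; apply: W12; exact: subset_closure.
  rewrite g0 gL in j; exists l => //; have n0 : 0 <= n%:R :> R by []; lra.
move=> /existsNP[t /not_implyP[/andP[t0 tL] nWt]].
have g1 := ageo_sub gg (lexx 0) t0 tL.
have g2 := ageo_rev (ageo_sub gg t0 tL (lexx L)).
have [||s [/andP[s0 st] Ks [l1 j1 h1]]] := exit _ _ _ g1 => //; first by rewrite g0.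
have [||s' [/andP[s'L ts'] Ks' [l2 j2 h2]]] := exit _ _ _ g2; rewrite ?opprK ?gL//.
rewrite opprK gL in j2; rewrite g0 in j1.
have Jss' : joined (U `&` Omega) (g s) (g (- s')).
  apply: joined_trans (_ : joined _ (g s) z) _; first by exists l1; exact: chain_sym.
  by apply: joined_trans Jzw _; exists l2.
have [k jk hk] := Hn _ _ Ks Ks' Jss'.
exists (l1 + (k + l2)); first by apply: chain_trans j1 _; apply: chain_trans jk _; exact: chain_sym.
lra.
Qed.
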